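(* Let $G$ be a linearly ordered abelian group (written additively), $F$ an algebraically closed field of characteristic $0$, and let $R=M_4(F)$ carry a $G$-grading whose neutral component is commutative. Then the $T_G$-ideal $T_G(R)$ of graded identities of $R$ is generated, as a $T_G$-ideal, by the identities (i) $x_1x_2-x_2x_1$ with $\deg x_1=\deg x_2=0$; (ii) $x_1x_2x_3-x_3x_2x_1$ with $\deg x_1=-\deg x_2=\deg x_3\neq 0$; (iii) $x_1$ with $R_{\deg x_1}=0$; if and only if there exist $a,b\in G$ with $a,b>0$, $a\neq 2b$ and $2a\neq b$, such that the grading on $R$ is isomorphic to the elementary grading on $M_4(F)$ induced by $(0,a,a+b,2a+b)$.
   Context: A linearly ordered group is a group with a translation-invariant total order. The elementary grading on $M_n(F)$ induced by $(g_1,\dots,g_n)$ is $R_g=\mathrm{span}\{e_{pq}: g_q-g_p=g\}$. Graded polynomials are elements of the free associative algebra on variables each having a prescribed degree in $G$; $T_G(R)$ is the set of graded polynomials vanishing under every substitution of each variable $x$ by an element of $R_{\deg x}$. A $T_G$-ideal is an ideal of the free $G$-graded algebra invariant under all degree-preserving endomorphisms, and a set generates a $T_G$-ideal if the latter is the smallest $T_G$-ideal containing it. Two $G$-gradings are isomorphic if there is an algebra isomorphism $\varphi$ with $\varphi(A_g)=B_g$ for all $g$. *)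

(* Defs.v *)
From HB Require Import structures.
From mathcomp Require Import all_boot all_order all_algebra.
Set Implicit Arguments. Unset Strict Implicit. Unset Printing Implicit Defensive.
Import Order.TTheory GRing.Theory Num.Theory.
Local Open Scope ring_scope.

Definition ordered_group (G : zmodType) (le : rel G) : Prop :=
  [/\ reflexive le, antisymmetric le, transitive le, total le
    & forall a b c : G, le a b -> le (a + c) (b + c)].

Definition gpos (G : zmodType) (le : rel G) (a : G) : bool := le 0 a && (a != 0).

Definition is_grading (G : zmodType) (F : fieldType)
  (Rg : G -> {vspace 'M[F]_4}) : Prop :=
  (exists s : seq G, [/\ uniq s,
      (forall g, g \notin s -> Rg g = 0%VS),
      (\sum_(g <- s) Rg g)%VS = fullv
    & directv (\sum_(g <- s) Rg g)]) /\
  (forall (g h : G) (x y : 'M[F]_4), x \in Rg g -> y \in Rg h -> x * y \in Rg (g + h)).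

Definition elem_grading (G : zmodType) (F : fieldType) (gs : 'I_4 -> G)
  (g : G) : {vspace 'M[F]_4} :=
  <<[seq (delta_mx p q : 'M[F]_4) | p <- enum 'I_4,
        q <- [seq q <- enum 'I_4 | gs q - gs p == g]]>>%VS.

Arguments elem_grading {G F} gs g.

Definition iso_gradings (G : zmodType) (F : fieldType)
  (A B : G -> {vspace 'M[F]_4}) : Prop :=
  exists f : {lrmorphism 'M[F]_4 -> 'M[F]_4},
    bijective f /\
    forall (g : G) (y : 'M[F]_4), y \in B g <-> exists2 x, x \in A g & y = f x.

(* Variables: x_(g,n) has degree g (countably many variables of each degree).
   A graded polynomial is represented by a formal list of (coefficient, word);
   the polynomial it denotes is given by its coefficient function gcoef.
   Sets of polynomials are predicates on these representations and T_G-ideals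
   are required to be closed under equality of denoted polynomials. *)
Section FreeGraded.
Variables (G : zmodType) (F : fieldType).

Definition gvar := (G * nat)%type.
Definition gdeg (x : gvar) : G := x.1.
Definition gpoly := seq (F * seq gvar).

Definition gcoef (p : gpoly) (w : seq gvar) : F :=
  \sum_(m <- p) (if m.2 == w then m.1 else 0).
Definition gpoly_eqv (p q : gpoly) : Prop := forall w, gcoef p w = gcoef q w.

Definition gzero : gpoly := [::].
Definition gone : gpoly := [:: (1, [::])].
Definition gvarp (x : gvar) : gpoly := [:: (1, [:: x])].
Definition gadd (p q : gpoly) : gpoly := p ++ q.
Definition gscale (c : F) (p : gpoly) : gpoly := [seq (c * m.1, m.2) | m <- p].
Definition gsub (p q : gpoly) : gpoly := gadd p (gscale (-1) q).
Definition gmul (p q : gpoly) : gpoly :=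
  [seq (m.1 * n.1, m.2 ++ n.2) | m <- p, n <- q].

Definition wdeg (w : seq gvar) : G := \sum_(x <- w) gdeg x.
Definition ghomog (g : G) (p : gpoly) : Prop :=
  forall w, gcoef p w != 0 -> wdeg w = g.

Definition gsubst (phi : gvar -> gpoly) (p : gpoly) : gpoly :=
  flatten [seq gscale m.1 (foldr (fun x acc => gmul (phi x) acc) gone m.2) | m <- p].

Definition TG_ideal (I : gpoly -> Prop) : Prop :=
  [/\ I gzero /\ (forall p q, gpoly_eqv p q -> I p -> I q),
      (forall p q, I p -> I q -> I (gadd p q)),
      (forall c p, I p -> I (gscale c p)),
      (forall p q, I p -> I (gmul q p) /\ I (gmul p q))
    & (forall phi p, (forall x, ghomog (gdeg x) (phi x)) -> I p -> I (gsubst phi p))].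

Definition TG_generated (S T : gpoly -> Prop) : Prop :=
  [/\ TG_ideal T, (forall p, S p -> T p)
    & forall I, TG_ideal I -> (forall p, S p -> I p) -> forall p, T p -> I p].

Definition geval (s : gvar -> 'M[F]_4) (p : gpoly) : 'M[F]_4 :=
  \sum_(m <- p) m.1 *: \prod_(x <- m.2) s x.

Definition TG_ids (Rg : G -> {vspace 'M[F]_4}) (p : gpoly) : Prop :=
  forall s : gvar -> 'M[F]_4, (forall x, s x \in Rg (gdeg x)) -> geval s p = 0.

Definition gens_11 (Rg : G -> {vspace 'M[F]_4}) (p : gpoly) : Prop :=
  (exists x1 x2 : gvar, [/\ gdeg x1 = 0, gdeg x2 = 0 &
      p = gsub (gmul (gvarp x1) (gvarp x2)) (gmul (gvarp x2) (gvarp x1))]) \/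
  (exists x1 x2 x3 : gvar, [/\ gdeg x1 = - gdeg x2, gdeg x3 = gdeg x1, gdeg x1 != 0 &
      p = gsub (gmul (gvarp x1) (gmul (gvarp x2) (gvarp x3)))
               (gmul (gvarp x3) (gmul (gvarp x2) (gvarp x1)))]) \/
  (exists x1 : gvar, Rg (gdeg x1) = 0%VS /\ p = gvarp x1).

End FreeGraded.

Definition seq4 (G : zmodType) (a b : G) (i : 'I_4) : G :=
  nth 0 [:: 0; a; a + b; a *+ 2 + b] i.

(* Main.v *)
Require Import Defs.
From HB Require Import structures.
From mathcomp Require Import all_boot all_order perm all_algebra ring zify.
Import Order.TTheory GRing.Theory Num.Theory.
Set Implicit Arguments. Unset Strict Implicit. Unset Printing Implicit Defensive.
Local Open Scope ring_scope.

(** A grading with commutative neutral component R_0 is elementary, induced by distinct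
    degrees T_0 < ... < T_3: elements of nonzero degree are nilpotent, so the trace form
    pairs R_g with R_{-g}; hence R_0 is reduced, simultaneously diagonalizable, and in
    fact the full diagonal algebra, so that the matrix units are homogeneous.

    For an elementary grading a word is a walk in G, given by its partial degree sums.
    Modulo (i) and (ii) two words with the same multiset of labelled edges are congruent,
    and generic matrices show that an identity has coefficient sum 0 on each such class
    of words having a translate that stays inside T. A word all of whose translates leave
    T is an identity; it follows from (iii) as soon as one of its subwords has degree
    outside T - T. So the generators suffice when every finite S with S - S inside T - T
    has a translate inside T, which holds for T = {0, a, a + b, 2a + b} if a <> 2b and
    2a <> b. Conversely, S = - T forces T to be of this form, and the progressions
    {0, b, 2b, 3b} and {0, a, 2a, 3a} rule out a = 2b and b = 2a. *)

(** * Graded polynomials and T_G-ideals *)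

Section FreeAlgebra.
Variables (G : zmodType) (F : fieldType).
Implicit Types (p q : gpoly G F) (w u v : seq (gvar G)) (c : F).

Definition gmono w : gpoly G F := [:: (1, w)].

Lemma gcoef_add p q w : gcoef (gadd p q) w = gcoef p w + gcoef q w.
Proof. by rewrite /gcoef big_cat. Qed.

Lemma gcoef_scale c p w : gcoef (gscale c p) w = c * gcoef p w.
Proof.
rewrite /gcoef big_map mulr_sumr; apply: eq_bigr => m _ /=.
by case: ifP; rewrite ?mulr0.
Qed.

Lemma gcoef_sub p q w : gcoef (gsub p q) w = gcoef p w - gcoef q w.
Proof. by rewrite gcoef_add gcoef_scale mulN1r. Qed.

Lemma gcoef_cons m p w : gcoef (m :: p) w = (if m.2 == w then m.1 else 0) + gcoef p w.
Proof. by rewrite /gcoef big_cons. Qed.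

Lemma gcoef0 w : gcoef (gzero G F) w = 0.
Proof. by rewrite /gcoef big_nil. Qed.

Lemma gmul_mono u v : gmul (gmono u) (gmono v) = gmono (u ++ v).
Proof. by rewrite /gmul /gmono /= mulr1. Qed.

Lemma ghomog_mono w : ghomog (wdeg w) (gmono w).
Proof.
move=> v; rewrite gcoef_cons gcoef0 addr0 /=.
by have [->//|_] := eqVneq w v; rewrite eqxx.
Qed.

Lemma wdeg_cons x w : wdeg (x :: w) = gdeg x + wdeg w.
Proof. by rewrite /wdeg big_cons. Qed.

Lemma wdeg_cat u v : wdeg (u ++ v) = wdeg u + wdeg v.
Proof. by rewrite /wdeg big_cat. Qed.

Lemma wdeg_nil : wdeg ([::] : seq (gvar G)) = 0.
Proof. by rewrite /wdeg big_nil. Qed.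

Lemma gsubst_mono (f : gvar G -> seq (gvar G)) p :
  gsubst (fun x => gmono (f x)) p = [seq (m.1, flatten (map f m.2)) | m <- p].
Proof.
rewrite /gsubst; elim: p => //= m p ->.
suff -> : foldr (fun x acc => gmul (gmono (f x)) acc) (gone G F) m.2
          = gmono (flatten (map f m.2)) by rewrite /gmono /= mulr1.
by elim: m.2 => //= x w ->; rewrite gmul_mono.
Qed.

(** A list may repeat a word or carry terms that cancel. Grouping by words shows that evaluation
    depends only on the denoted polynomial. *)
Lemma geval_coef (s : gvar G -> 'M[F]_4) p (ws : seq (seq (gvar G))) :
  uniq ws -> {subset map snd p <= ws} ->
  geval s p = \sum_(w <- ws) gcoef p w *: \prod_(x <- w) s x.
Proof.
move=> uws; elim: p => [|m p IH] sub.
  by rewrite /geval big_nil big1 // => w _; rewrite gcoef0 scale0r.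
rewrite /geval big_cons -/(geval s p) IH; last first.
  by move=> w wp; apply: sub; rewrite inE wp orbT.
under [RHS]eq_bigr do rewrite gcoef_cons scalerDl.
rewrite big_split /=; congr (_ + _).
have m2 : m.2 \in ws by apply: sub; rewrite inE eqxx.
rewrite (bigD1_seq m.2) //= eqxx [X in _ + X]big1 ?addr0 // => w.
by rewrite eq_sym => /negbTE ->; rewrite scale0r.
Qed.

Lemma geval_eqv (s : gvar G -> 'M[F]_4) p q :
  gpoly_eqv p q -> geval s p = geval s q.
Proof.
move=> pq; pose ws := undup (map snd p ++ map snd q).
have uws : uniq ws by apply: undup_uniq.
rewrite (geval_coef s uws); last by move=> w wp; rewrite mem_undup mem_cat wp.
rewrite (geval_coef s uws); last by move=> w wp; rewrite mem_undup mem_cat wp orbT.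
by apply: eq_bigr => w _; rewrite pq.
Qed.

Lemma geval_add (s : gvar G -> 'M[F]_4) p q : geval s (gadd p q) = geval s p + geval s q.
Proof. by rewrite /geval big_cat. Qed.

Lemma geval_scale (s : gvar G -> 'M[F]_4) c p : geval s (gscale c p) = c *: geval s p.
Proof.
by rewrite /geval big_map scaler_sumr; apply: eq_bigr => m _; rewrite scalerA.
Qed.

Lemma geval_mul (s : gvar G -> 'M[F]_4) p q : geval s (gmul p q) = geval s p * geval s q.
Proof.
rewrite /geval /gmul big_allpairs_dep mulr_suml; apply: eq_bigr => m _.
rewrite mulr_sumr; apply: eq_bigr => n _ /=.
by rewrite big_cat -scalerAl -scalerAr scalerA.
Qed.

Lemma geval_mono (s : gvar G -> 'M[F]_4) w : geval s (gmono w) = \prod_(x <- w) s x.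
Proof. by rewrite /geval /gmono big_seq1 scale1r. Qed.

Lemma geval_subst (s : gvar G -> 'M[F]_4) phi p :
  geval s (gsubst phi p) = geval (fun x => geval s (phi x)) p.
Proof.
rewrite /gsubst {1}/geval big_flatten big_map.
apply: eq_bigr => m _; rewrite -[LHS]/(geval s (gscale _ _)) geval_scale; congr (_ *: _).
elim: m.2 => [|x w IH] /=; first by rewrite -[gone G F]/(gmono [::]) geval_mono !big_nil.
by rewrite geval_mul IH big_cons.
Qed.

Lemma TG_ideal_ids (R : G -> {vspace 'M[F]_4}) :
  1 \in R 0 ->
  (forall (g h : G) (x y : 'M[F]_4), x \in R g -> y \in R h -> x * y \in R (g + h)) ->
  TG_ideal (TG_ids R).
Proof.
move=> R1 RM; split.
- split=> [s _|p q pq Ip s sR]; first by rewrite /geval big_nil.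
  by rewrite -(geval_eqv s pq) Ip.
- by move=> p q Ip Iq s sR; rewrite geval_add Ip ?Iq ?addr0.
- by move=> c p Ip s sR; rewrite geval_scale Ip ?scaler0.
- by move=> p q Ip; split=> s sR; rewrite geval_mul Ip ?mulr0 ?mul0r.
move=> phi p phiH Ip s sR; rewrite geval_subst; apply: Ip => x.
have RW w : \prod_(y <- w) s y \in R (wdeg w).
  elim: w => [|y w IH]; first by rewrite big_nil wdeg_nil.
  by rewrite big_cons wdeg_cons RM.
have sub : {subset map snd (phi x) <= undup (map snd (phi x))}.
  by move=> w; rewrite mem_undup.
rewrite (geval_coef s (undup_uniq _) sub); apply: rpred_sum => w _.
have [->|c0] := eqVneq (gcoef (phi x) w) 0; first by rewrite scale0r mem0v.
by rewrite -(phiH x w c0) rpredZ.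
Qed.

Lemma TG_ideal_capl (I J : gpoly G F -> Prop) :
  TG_ideal I -> TG_ideal J -> TG_ideal (fun p => I p /\ J p).
Proof.
move=> [[I0 Ie] Ia Is Im If] [[J0 Je] Ja Js Jm Jf]; split.
- by split=> // p q pq [/(Ie _ _ pq) ? /(Je _ _ pq)].
- by move=> p q [? ?] [? ?]; split; [apply: Ia | apply: Ja].
- by move=> c p [? ?]; split; [apply: Is | apply: Js].
- by move=> p q [/(Im _ q)[? ?] /(Jm _ q)[? ?]].
by move=> phi p hphi [? ?]; split; [apply: If | apply: Jf].
Qed.

Lemma TG_ideal_ext (I J : gpoly G F -> Prop) :
  (forall p, I p <-> J p) -> TG_ideal I -> TG_ideal J.
Proof.
move=> IJ [[I0 Ie] Ia Is Im If]; split.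
- split=> [|p q pq /IJ/(Ie _ _ pq)]; first exact/IJ.
  by move/IJ.
- by move=> p q /IJ Ip /IJ Iq; apply/IJ/Ia.
- by move=> c p /IJ Ip; apply/IJ/Is.
- by move=> p q /IJ /(Im _ q)[? ?]; split; apply/IJ.
by move=> phi p hphi /IJ Ip; apply/IJ/If.
Qed.

Lemma TG_generated_ext (S S' T T' : gpoly G F -> Prop) :
  (forall p, S p <-> S' p) -> (forall p, T p <-> T' p) ->
  TG_generated S T -> TG_generated S' T'.
Proof.
move=> SS TT [idT ST gen]; split.
- exact: TG_ideal_ext TT idT.
- by move=> p /SS/ST/TT.
by move=> I idI SI p /TT; apply: gen => // q /SS/SI.
Qed.

End FreeAlgebra.

(** * Congruence of words modulo the generators *)

Section Congruence.
Variables (G : zmodType) (F : fieldType) (I : gpoly G F -> Prop).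
Hypothesis idI : TG_ideal I.
Implicit Types (p q : gpoly G F) (w u v : seq (gvar G)).

Definition gcong w w' := I (gsub (gmono F w) (gmono F w')).

Let Ieqv p q : gpoly_eqv p q -> I p -> I q.
Proof. by case: idI => -[_ h] _ _ _ _; apply: h. Qed.

Lemma gcong_refl w : gcong w w.
Proof.
case: idI => -[I0 _] _ _ _ _; apply: Ieqv I0 => v.
by rewrite gcoef_sub subrr gcoef0.
Qed.

Lemma gcong_trans w w' w'' : gcong w w' -> gcong w' w'' -> gcong w w''.
Proof.
case: idI => _ Ia _ _ _ h h'; apply: Ieqv (Ia _ _ h h') => v.
by rewrite gcoef_add !gcoef_sub subrKA.
Qed.

Lemma gcong_ctx u v w w' : gcong w w' -> gcong (u ++ w ++ v) (u ++ w' ++ v).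
Proof.
case: idI => _ _ _ Im _ /(Im _ (gmono F v))[_] /(Im _ (gmono F u))[+ _].
by rewrite /gcong /gmono /gsub /gadd /gscale /gmul /= !mulr1 !mul1r.
Qed.

Lemma ideal_word_ctx u v w : I (gmono F w) -> I (gmono F (u ++ w ++ v)).
Proof.
case: idI => _ _ _ Im _ /(Im _ (gmono F v))[_] /(Im _ (gmono F u))[+ _].
by rewrite !gmul_mono.
Qed.

(** Carries the generators, stated for single variables, over to arbitrary words of the same
    degrees. *)
Lemma ideal_subst_words p (f : gvar G -> seq (gvar G)) :
  (forall x, wdeg (f x) = gdeg x) -> I p ->
  I [seq (m.1, flatten (map f m.2)) | m <- p].
Proof.
move=> hf; rewrite -gsubst_mono; case: idI => _ _ _ _; apply => x.
by rewrite -hf; apply: ghomog_mono.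
Qed.

Variable Rg : G -> {vspace 'M[F]_4}.
Hypothesis genI : forall p, gens_11 Rg p -> I p.

Lemma gcong_swap u v : wdeg u = 0 -> wdeg v = 0 -> gcong (u ++ v) (v ++ u).
Proof.
(* The second components keep the two variables of degree 0 apart. *)
move=> u0 v0; pose x1 : gvar G := (0, 0%N); pose x2 : gvar G := (0, 1%N).
have := @ideal_subst_words _
  (fun x => if x == x1 then u else if x == x2 then v else [:: x]) _
  (genI (or_introl (ex_intro _ x1 (ex_intro _ x2 (And3 erefl erefl erefl))))).
have e21 : (x2 == x1) = false by rewrite xpair_eqE andbF.
rewrite /gcong /gsub /gadd /= !mulr1 !cats0 !eqxx e21 /=; apply=> x.
case: eqP => [->//|_]; case: eqP => [->//|_].
by rewrite wdeg_cons wdeg_nil addr0.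
Qed.

Lemma gcong_rev3 u v w : wdeg u = - wdeg v -> wdeg w = wdeg u -> wdeg u != 0 ->
  gcong (u ++ v ++ w) (w ++ v ++ u).
Proof.
move=> uv wu u0.
pose x1 : gvar G := (wdeg u, 0%N); pose x2 : gvar G := (wdeg v, 1%N).
pose x3 : gvar G := (wdeg u, 2%N).
have := @ideal_subst_words _
  (fun x => if x == x1 then u else if x == x2 then v else if x == x3 then w else [:: x]) _
  (genI (or_intror (or_introl (ex_intro _ x1 (ex_intro _ x2 (ex_intro _ x3
    (And4 uv erefl u0 erefl))))))).
have e21 : (x2 == x1) = false by rewrite xpair_eqE andbF.
have e31 : (x3 == x1) = false by rewrite xpair_eqE andbF.
have e32 : (x3 == x2) = false by rewrite xpair_eqE andbF.
rewrite /gcong /gsub /gadd /= !mulr1 !eqxx e21 e31 e32 /= !cats0; apply=> x.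
case: eqP => [->//|_]; case: eqP => [->//|_]; case: eqP => [->//|_].
by rewrite wdeg_cons wdeg_nil addr0.
Qed.

Lemma ideal_word_support w : Rg (wdeg w) = 0%VS -> I (gmono F w).
Proof.
move=> R0; pose x1 : gvar G := (wdeg w, 0%N).
have := @ideal_subst_words _ (fun x => if x == x1 then w else [:: x]) _
  (genI (or_intror (or_intror (ex_intro _ x1 (conj R0 erefl))))).
rewrite /= eqxx cats0; apply=> x.
by case: eqP => [->//|_]; rewrite wdeg_cons wdeg_nil addr0.
Qed.

(** The edges of the walk in G that starts at [g]: each is stored as its label and its source, the
    target being the source plus the degree of the label. *)
Fixpoint trace (g : G) w : seq (gvar G * G) :=
  if w is x :: w' then (x, g) :: trace (g + gdeg x) w' else [::].

Lemma trace_cat g u v : trace g (u ++ v) = trace g u ++ trace (g + wdeg u) v.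
Proof.
elim: u g => [|x u IH] g /=; first by rewrite wdeg_nil addr0.
by rewrite IH wdeg_cons addrA.
Qed.

Lemma mem_traceP g w e :
  reflect (exists u v, w = u ++ e.1 :: v /\ e.2 = g + wdeg u) (e \in trace g w).
Proof.
apply: (iffP idP) => [|[u [v [-> e2]]]]; last first.
  by rewrite trace_cat -e2 mem_cat /= inE -surjective_pairing eqxx orbT.
elim: w g => // x w IH g /=; rewrite inE => /orP[/eqP->|/IH[u [v [-> ->]]]].
  by exists [::], w; rewrite wdeg_nil addr0.
by exists (x :: u), v; rewrite wdeg_cons addrA.
Qed.

(** A walk from inside [S] to a vertex outside it must cross the boundary. Below, [S] consists of
    the vertices visited by a subtrail. *)
Lemma trace_leaves (S : pred G) g w y h :
  S g -> (y, h) \in trace g w -> ~~ S h ->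
  exists e, [/\ e \in trace g w, S e.2 & ~~ S (e.2 + gdeg e.1)].
Proof.
elim: w g => // x w IH g Sg /=; rewrite inE => /orP[/eqP[_ ->]|yw Sh].
  by rewrite Sg.
have [Sx|Sx] := boolP (S (g + gdeg x)); last by exists (x, g); rewrite inE eqxx.
by have [e [ew ? ?]] := IH _ Sx yw Sh; exists e; rewrite inE ew orbT.
Qed.

(* Words with equal traces are Eulerian trails of the same labelled multigraph;
   two such trails are connected by swaps of adjacent closed subtrails (rule i)
   and by exchanges of the two parallel outer arcs of u -> v -> w (rule ii). *)
Lemma trace_gcong g w w' : perm_eq (trace g w) (trace g w') -> gcong w w'.
Proof.
elim: w g w' => [|x w IH] g w' pe.
  by move: pe; rewrite perm_sym => /perm_nilP; case: w' => // _; apply: gcong_refl.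
(* It suffices to bring the edge [(x, g)] to the front of [w']; the induction hypothesis handles the
   rest. *)
suff [v cv pv] : exists2 v, gcong (x :: v) w' &
    perm_eq (trace g w') (trace g (x :: v)).
  have := perm_trans pe pv; rewrite /= perm_cons => /IH c.
  apply: gcong_trans cv; have := gcong_ctx [:: x] [::] c.
  by rewrite /= !cats0.
have /mem_traceP[u [v [/= w'E]]] : (x, g) \in trace g w'.
  by rewrite -(perm_mem pe) inE eqxx.
rewrite -{1}[g]addr0 => /addrI/esym u0.
case: u w'E u0 => [|y u] w'E u0.
  by exists v; rewrite w'E //; apply: gcong_refl.
set u' := y :: u in w'E u0.
(* Now [u'] is a closed trail at [g]. If the trail returns to [g] after [x], then [u'] is followed
   by another closed trail at [g] and rule (i) swaps the two. *)
have [/hasP[i _ /eqP i0]|/hasPn noret] :=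
    boolP (has (fun i => gdeg x + wdeg (take i v) == 0) (iota 0 (size v).+1)).
  set v1 := take i v in i0; set v2 := drop i v.
  have vE : v = v1 ++ v2 by rewrite cat_take_drop.
  exists (v1 ++ u' ++ v2).
    have := @gcong_swap (x :: v1) u'; rewrite wdeg_cons => /(_ i0 u0) /(gcong_ctx [::] v2).
    by rewrite !cat0s -!catA w'E vE.
  change (perm_eq (trace g w') (trace g ((x :: v1) ++ u' ++ v2))).
  have -> : w' = u' ++ (x :: v1) ++ v2 by rewrite w'E vE.
  by rewrite !trace_cat !wdeg_cons i0 -wdeg_cons u0 !addr0 perm_catCA.
(* Otherwise let [S] be the vertices visited after [x], so that [g] is not in [S]. The trail [w]
   starts in [S] and visits [g], hence leaves [S] along an edge [e]. This edge cannot belong to [v],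
   so it lies in [u'], and its source is a common vertex of [u'] and [v]. *)
pose S h := has (fun i => h == g + gdeg x + wdeg (take i v)) (iota 0 (size v).+1).
have Sx : S (g + gdeg x) by apply/hasP; exists 0%N; rewrite ?take0 ?wdeg_nil ?addr0.
have Sg : ~~ S g.
  apply/hasPn => i /noret; apply: contraNN.
  by rewrite -{1}[g]addr0 -addrA (inj_eq (addrI g)) eq_sym.
have pw : perm_eq (trace (g + gdeg x) w) (trace g u' ++ trace (g + gdeg x) v).
  rewrite -(perm_cons (x, g)); apply: (perm_trans pe).
  by rewrite w'E trace_cat u0 addr0 perm_catC cat_cons perm_cons perm_catC.
have yw : (y, g) \in trace (g + gdeg x) w.
  by rewrite (perm_mem pw) mem_cat inE eqxx.
have [e [ew Se Se']] := trace_leaves Sx yw Sg.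
have /mem_traceP[u1 [u2 [u'E e2]]] : e \in trace g u'.
  move: ew; rewrite (perm_mem pw) mem_cat => /orP[//|/mem_traceP[v1 [v2 [vE e2]]]].
  case/hasP: Se'; exists (size v1).+1.
    by rewrite mem_iota vE size_cat /= add0n addnS !ltnS leq_addr.
  rewrite vE -cat_rcons take_size_cat ?size_rcons //.
  by rewrite -cats1 wdeg_cat wdeg_cons wdeg_nil addr0 addrA e2.
have /hasP[i iv /eqP ei] := Se.
set v1 := take i v in ei; set v2 := drop i v.
have vE : v = v1 ++ v2 by rewrite cat_take_drop.
have du : wdeg u1 = wdeg (x :: v1).
  by apply: (addrI g); rewrite -e2 ei wdeg_cons addrA.
have dn0 : wdeg u1 != 0.
  by apply: contraNN Sg => /eqP d0; rewrite -[g]addr0 -d0 -e2.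
have u2E : wdeg (e.1 :: u2) = - wdeg u1.
  by apply/eqP; rewrite -addr_eq0 addrC -wdeg_cat -u'E u0.
(* Both [u1] and [x :: v1] lead from [g] to the source of [e], and [e.1 :: u2] leads back; rule (ii)
   exchanges the outer two. *)
exists (v1 ++ (e.1 :: u2) ++ u1 ++ v2).
  have := @gcong_rev3 (x :: v1) (e.1 :: u2) u1.
  rewrite -du u2E opprK => /(_ erefl erefl dn0) /(gcong_ctx [::] v2).
  by rewrite !cat0s -!catA w'E vE u'E -catA.
change (perm_eq (trace g w') (trace g ((x :: v1) ++ (e.1 :: u2) ++ u1 ++ v2))).
have -> : w' = u1 ++ (e.1 :: u2) ++ (x :: v1) ++ v2 by rewrite w'E vE u'E -!catA.
rewrite !(trace_cat _ _ (_ ++ _)) !(trace_cat _ _ v2) u2E -du !addrK.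
by apply/seq.permP => P; rewrite !count_cat addnCA [RHS]addnCA; congr addn; rewrite addnCA.
Qed.

End Congruence.

(** * Generic evaluation of elementary gradings *)

Section Separation.
Local Open Scope nat_scope.

Fixpoint prime_seq k := if k is k'.+1 then s2val (prime_above (prime_seq k')) else 2.

Lemma prime_seqP k : prime (prime_seq k).
Proof. by case: k => // k /=; case: (prime_above _). Qed.

Lemma prime_seq_inj : injective prime_seq.
Proof.
have mono : {homo prime_seq : m n / m < n}.
  apply: (homo_ltn (@ltn_trans)) => k /=; by case: (prime_above _).
move=> m n; case: (ltngtP m n) => // /mono + e; by rewrite e ltnn.
Qed.

(** Codes a multiset of letters of [E0] by a natural number; unique factorization recovers the
    multiplicities. *)
Definition godel (E : eqType) (E0 s : seq E) := \prod_(e <- s) prime_seq (index e E0).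

Lemma godel_gt0 (E : eqType) (E0 s : seq E) : 0 < godel E0 s.
Proof. by apply: prodn_cond_gt0 => e _; apply/prime_gt0/prime_seqP. Qed.

Lemma logn_godel (E : eqType) (E0 s : seq E) e :
  {subset s <= E0} -> e \in E0 ->
  logn (prime_seq (index e E0)) (godel E0 s) = count_mem e s.
Proof.
move=> + eE; elim: s => [|x s IH] sub; first by rewrite /godel big_nil logn1.
have xE : x \in E0 by apply: sub; rewrite inE eqxx.
rewrite /godel big_cons -/(godel E0 s) lognM ?godel_gt0 ?prime_gt0 ?prime_seqP //.
rewrite IH => [|y ys]; last by apply: sub; rewrite inE ys orbT.
rewrite logn_prime ?prime_seqP //= (inj_eq prime_seq_inj); congr (nat_of_bool _ + _).
by apply/eqP/eqP => [h|->//]; rewrite -[x](nth_index e xE) -h nth_index.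
Qed.

Lemma godel_inj (E : eqType) (E0 s s' : seq E) :
  {subset s <= E0} -> {subset s' <= E0} -> godel E0 s = godel E0 s' -> perm_eq s s'.
Proof.
move=> sE sE' ss'; apply/allP => e; rewrite mem_cat => es.
have eE : e \in E0 by case/orP: es => [/sE|/sE'].
by rewrite /= -(logn_godel sE eE) ss' logn_godel.
Qed.

End Separation.

(** By linearity powers may be replaced by any polynomial; one that vanishes at every value other
    than [v], but not at [v], isolates the wanted sum. *)
Lemma power_sums_separate (F : fieldType) (l : seq (F * F)) :
  (forall r, \sum_(m <- l) m.1 * m.2 ^+ r = 0) ->
  forall v, \sum_(m <- l | m.2 == v) m.1 = 0.
Proof.
move=> lr v.
have lq (q : {poly F}) : \sum_(m <- l) m.1 * q.[m.2] = 0.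
  under eq_bigr => m _ do rewrite horner_coef mulr_sumr.
  rewrite exchange_big big1 //= => i _.
  under eq_bigr => m _ do rewrite mulrCA.
  by rewrite -mulr_sumr lr mulr0.
pose us := [seq m.2 | m <- l & m.2 != v].
have := lq (\prod_(u <- us) ('X - u%:P)).
rewrite (bigID (fun m => m.2 == v)) /= [X in _ + X]big1_seq ?addr0; last first.
  move=> m /andP[mv ml]; rewrite [X in _ * X](_ : _ = 0) ?mulr0 //.
  apply/eqP; rewrite -/(root _ _) root_prod_XsubC.
  by apply/mapP; exists m; rewrite // mem_filter mv.
under eq_bigr => m /eqP -> do [].
rewrite -mulr_suml => /eqP; rewrite mulf_eq0 => /orP[/eqP //|].
rewrite -/(root _ _) root_prod_XsubC => /mapP[m]; rewrite mem_filter => /andP[mv _] vE.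
by rewrite vE eqxx in mv.
Qed.

Lemma natr_pchar0_inj (F : fieldType) : [pchar F] =i pred0 -> injective (fun n => n%:R : F).
Proof.
move=> /pcharf0P F0 m n; wlog mn : m n / (m <= n)%N.
  by move=> H /[dup] e; case: (leqP m n) => [|/ltnW] mn; [|move/esym] => /H-/(_ mn).
move=> e; apply/eqP; rewrite eqn_leq mn -subn_eq0 -F0 natrB //=.
by rewrite e subrr.
Qed.

(* Generic evaluation: letters are sent to powers of distinct primes, so that
   distinct monomials take distinct values. *)
Lemma monomials_separate (F : fieldType) (E : eqType) (l : seq (F * seq E)) (P : pred (F * seq E)) :
  [pchar F] =i pred0 ->
  (forall t : E -> F, \sum_(m <- l | P m) m.1 * \prod_(e <- m.2) t e = 0) ->
  forall s, \sum_(m <- l | P m && perm_eq m.2 s) m.1 = 0.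
Proof.
move=> F0 lt s; pose E0 := flatten (map snd l) ++ s.
pose val s : F := (godel E0 s)%:R.
have sE : {subset s <= E0} by move=> e es; rewrite mem_cat es orbT.
apply: etrans (@power_sums_separate _ [seq (m.1, val m.2) | m <- l & P m] _ (val s)); last first.
  move=> r; rewrite big_map big_filter -[RHS](lt (fun e => (prime_seq (index e E0))%:R ^+ r)).
  by apply: eq_bigr => m _; rewrite /val natr_prod prodrXl.
rewrite big_map big_filter_cond /=.
rewrite big_seq_cond [RHS]big_seq_cond; apply: eq_bigl => m; case ml: (m \in l) => //=.
congr (_ && _); rewrite (inj_eq (natr_pchar0_inj F0)).
have mE : {subset m.2 <= E0}.
  by move=> e em; rewrite mem_cat; apply/orP; left; apply/flattenP; exists m.2; rewrite ?map_f.
apply/idP/eqP => [ms|]; last exact: godel_inj.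
exact: perm_big.
Qed.

(** * Homogeneous components and generic elements of an elementary grading *)

Section Elementary.
Variables (G : zmodType) (F : fieldType) (T : 'I_4 -> G).
Implicit Types (x y : 'M[F]_4) (w u v : seq (gvar G)).

Lemma mem_elem_grading g y :
  y \in elem_grading T g <-> forall p q, y p q != 0 -> T q - T p = g.
Proof.
rewrite /elem_grading; set X := (X in <<X>>%VS); split.
  move=> yX p q; have := coord_span (X := in_tuple X) yX => ->.
  apply: contra_neq_eq => pq; rewrite summxE big1 // => i _; rewrite mxE.
  have /allpairsPdep[p' [q' [_ + ->]]] : (in_tuple X)`_i \in X by apply: mem_nth.
  rewrite mem_filter => /andP[/eqP gE _]; rewrite mxE.
  have [pE|_] := eqVneq p p'; have [qE|_] := eqVneq q q'; rewrite /= ?mulr0 //.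
  by rewrite pE qE gE eqxx in pq.
move=> H; rewrite [y]matrix_sum_delta; apply: rpred_sum => p _; apply: rpred_sum => q _.
have [->|y0] := eqVneq (y p q) 0; first by rewrite scale0r mem0v.
apply/rpredZ/memv_span/allpairsPdep; exists p, q; rewrite mem_enum mem_filter mem_enum.
by split=> //; rewrite H ?eqxx.
Qed.

Lemma elem_grading1 : (1 : 'M[F]_4) \in elem_grading T 0.
Proof.
apply/mem_elem_grading => p q; rewrite mxE.
by have [->|_] := eqVneq p q; rewrite ?subrr ?eqxx.
Qed.

Lemma elem_gradingM (g h : G) x y :
  x \in elem_grading T g -> y \in elem_grading T h -> x * y \in elem_grading T (g + h).
Proof.
move=> /mem_elem_grading xg /mem_elem_grading yh; apply/mem_elem_grading => p q.
apply: contra_neq_eq => pq; rewrite mxE big1 // => k _; apply/eqP.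
apply: contraNT pq; rewrite mulf_eq0 negb_or => /andP[/xg <- /yh <-].
by rewrite [_ + (_ - _)]addrC subrKA.
Qed.

Lemma elem_grading_neq0 g : elem_grading T g <> (0%VS : {vspace 'M[F]_4}) -> 
  exists p q, g = T q - T p.
Proof.
move=> R0; have [/existsP[p /existsP[q /eqP->]]|/existsPn H] :=
  boolP [exists p, [exists q, g == T q - T p]]; first by exists p, q.
case: R0; apply/eqP; rewrite -subv0; apply/subvP => y /mem_elem_grading yg.
rewrite memv0; apply/eqP/matrixP => p q; rewrite [RHS]mxE; apply/eqP.
by apply: contraNT (H p) => /yg <-; apply/existsP; exists q.
Qed.

Lemma elem_grading_eq0 g p q :
  elem_grading T g = (0%VS : {vspace 'M[F]_4}) -> g != T q - T p.
Proof.
move=> R0; apply/eqP => gE.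
have : delta_mx p q \in elem_grading (F := F) T g.
  apply/mem_elem_grading => p' q'; rewrite mxE gE.
  by have [->|_] := eqVneq p' p; have [->|_] := eqVneq q' q; rewrite ?eqxx.
rewrite R0 memv0 => /eqP/matrixP/(_ p q)/eqP.
by rewrite !mxE !eqxx oner_eq0.
Qed.

Definition inT (g : G) := g \in codom T.
Definition vedge (e : gvar G * G) := inT e.2 && inT (e.2 + gdeg e.1).
Definition vwalk (p : 'I_4) w := all vedge (trace (T p) w).

(** A generic homogeneous element. For injective [T] each row has at most one nonzero entry, so a
    product of such matrices follows a walk, and its parameters are indexed exactly by the edges in
    [trace]. *)
Definition gen_subst (t : gvar G * G -> F) (x : gvar G) : 'M[F]_4 :=
  \matrix_(p, q) if T q - T p == gdeg x then t (x, T p) else 0.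

Lemma gen_subst_mem t (x : gvar G) : gen_subst t x \in elem_grading T (gdeg x).
Proof.
apply/mem_elem_grading => p q; rewrite mxE.
by have [->|_] := eqVneq (T q - T p) (gdeg x); rewrite ?eqxx.
Qed.

Hypothesis T_inj : injective T.

(** Summing over the row avoids naming the column where the walk ends. *)
Lemma gen_subst_row t w p :
  \sum_q (\prod_(x <- w) gen_subst t x) p q =
  if vwalk p w then \prod_(e <- trace (T p) w) t e else 0.
Proof.
elim: w p => [|x w IH] p; rewrite /vwalk /= ?big_nil ?big_cons.
  rewrite (bigD1 p) //= mxE eqxx big1 ?addr0 // => q; rewrite eq_sym mxE.
  by move/negbTE ->.
under eq_bigr => q _ do rewrite mxE.
rewrite exchange_big /=; under eq_bigr => k _ do rewrite -mulr_sumr IH mxE.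
rewrite /vedge /= /inT codom_f /=.
have [/codomP[k kE]|nT] := boolP (T p + gdeg x \in codom T); last first.
  rewrite big1 // => k _; case: eqP => [kE|]; last by rewrite mul0r.
  by case/negP: nT; rewrite -kE addrC subrK codom_f.
rewrite (bigD1 k) //= -{1}kE addrAC subrr add0r eqxx [X in _ + X]big1 ?addr0 => [|j jk].
  by rewrite /vwalk kE; case: ifP; rewrite ?mulr0 ?big_cons.
have [jE|_] := eqVneq (T j - T p) (gdeg x); last by rewrite mul0r.
by case/eqP: jk; apply: T_inj; rewrite -kE -jE addrC subrK.
Qed.

End Elementary.

(** * Identities of elementary gradings *)

Section ElementaryBasis.
Variables (G : zmodType) (F : fieldType) (T : 'I_4 -> G).
Hypothesis T_inj : injective T.
Implicit Types (x y z : 'M[F]_4) (u v w : seq (gvar G)) (p : gpoly G F).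

Lemma elem_grading0_diag x i j : x \in elem_grading T 0 -> i != j -> x i j = 0.
Proof.
move=> /mem_elem_grading x0; apply: contra_neq_eq => /x0/eqP.
by rewrite subr_eq0 => /eqP/T_inj.
Qed.

Lemma elem_grading0_comm x y :
  x \in elem_grading T 0 -> y \in elem_grading T 0 -> x * y = y * x.
Proof.
move=> x0 y0; apply/matrixP => i j; rewrite !mxE; apply: eq_bigr => k _.
have [->|ik] := eqVneq i k; last by rewrite !(elem_grading0_diag _ ik) // !mul0r.
have [->|kj] := eqVneq k j; first exact: mulrC.
by rewrite !(elem_grading0_diag _ kj) // !mulr0.
Qed.

(** The product [y * z] has degree 0, hence is diagonal, and a nonzero [x i j] fixes the only index
    that contributes to its entry at [j]. The resulting formula is symmetric in [x] and [z], which
    is identity (ii). *)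
Lemma elem_grading_mul3 g x y z i j :
  x \in elem_grading T g -> y \in elem_grading T (- g) -> z \in elem_grading T g ->
  (x * (y * z)) i j = x i j * (y j i * z i j).
Proof.
move=> xg yg zg.
have yz0 : y * z \in elem_grading T 0 by rewrite -(addNr g) elem_gradingM.
have E : (x * (y * z)) i j = x i j * (y * z) j j.
  rewrite mxE (bigD1 j) //= [X in _ + X]big1 ?addr0 // => k kj.
  by rewrite (elem_grading0_diag yz0) // mulr0.
rewrite E; have [->|xij] := eqVneq (x i j) 0; first by rewrite !mul0r.
congr (_ * _); rewrite mxE (bigD1 i) //= [X in _ + X]big1 ?addr0 // => k ki.
have [->|] := eqVneq (y j k) 0; first by rewrite mul0r.
move: yg => /mem_elem_grading yg /yg; move/mem_elem_grading: xg => /(_ _ _ xij) <-.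
by rewrite opprB => /addIr/T_inj kE; rewrite kE eqxx in ki.
Qed.

Lemma elem_grading_gens p : gens_11 (elem_grading T) p -> TG_ids (elem_grading T) p.
Proof.
case=> [[x1 [x2 [d1 d2 ->]]]|[[x1 [x2 [x3 [d1 d3 d0 ->]]]]|[x1 [R0 ->]]]] s sR.
- rewrite /gsub !(geval_add, geval_scale, geval_mul, geval_mono) !big_seq1 scaleN1r.
  have s1 := sR x1; have s2 := sR x2; rewrite d1 in s1; rewrite d2 in s2.
  by rewrite (elem_grading0_comm s1 s2) subrr.
- rewrite /gsub !(geval_add, geval_scale, geval_mul, geval_mono) !big_seq1 scaleN1r.
  have s1 := sR x1; have s2 := sR x2; have s3 := sR x3.
  rewrite d3 in s3; have d2 : gdeg x2 = - gdeg x1 by rewrite d1 opprK.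
  rewrite d2 in s2; apply/eqP; rewrite subr_eq0; apply/eqP/matrixP => i j.
  rewrite !(elem_grading_mul3 (g := gdeg x1)) //.
  by rewrite mulrCA [RHS]mulrCA [s x1 i j * _]mulrC.
by have := sR x1; rewrite R0 memv0 geval_mono big_seq1 => /eqP.
Qed.

Hypothesis F_char0 : [pchar F] =i pred0.
Hypothesis T_sets : forall S : seq G,
  (forall s s', s \in S -> s' \in S -> exists i j, s' - s = T j - T i) ->
  exists c, forall s, s \in S -> inT T (c + s).

(** Differences of partial degree sums of [w] are, up to sign, degrees of subwords. If all of these
    lie in T - T, [T_sets] translates the partial sums into T; the empty prefix then shows that the
    translation is itself some [T i]. *)
Lemma vwalk_or_subword w :
  (exists i, vwalk T i w) \/
  (exists u v v', w = u ++ v ++ v' /\ elem_grading T (wdeg v) = (0%VS : {vspace 'M[F]_4})).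
Proof.
pose pos := [seq wdeg (take i w) | i <- iota 0 (size w).+1].
pose bad := [exists i : 'I_(size w).+1, [exists j : 'I_(size w).+1,
  [&& (i <= j)%N & elem_grading T (wdeg (drop i (take j w))) == (0%VS : {vspace 'M[F]_4})]]].
have [/existsP[i /existsP[j /andP[ij /eqP R0]]]|nbad] := boolP bad.
  right; exists (take i w), (drop i (take j w)), (drop j w); split=> //.
  have {1}-> : take i w = take i (take j w) by rewrite take_takel.
  by rewrite catA !cat_take_drop.
left; have [c cP] : exists c, forall s, s \in pos -> inT T (c + s).
  have sub (i j : nat) : (i <= j)%N -> (j <= size w)%N ->
    exists k l, wdeg (take j w) - wdeg (take i w) = T l - T k.
    move=> ij jw; have iw := leq_trans ij jw.
    have -> : wdeg (take j w) - wdeg (take i w) = wdeg (drop i (take j w)).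
      rewrite -{1}(cat_take_drop i (take j w)) wdeg_cat take_takel //.
      by rewrite addrAC subrr add0r.
    apply: (@elem_grading_neq0 _ F) => R0; case/negP: nbad.
    apply/existsP; exists (Ordinal (iw : i < (size w).+1)%N); apply/existsP.
    by exists (Ordinal (jw : j < (size w).+1)%N); rewrite ij R0 eqxx.
  apply: T_sets => s s' /mapP[i + ->] /mapP[j + ->]; rewrite !mem_iota !ltnS => iw jw.
  case: (leqP i j) => [ij|/ltnW ji]; first exact: sub.
  have [k [l e]] := sub _ _ ji iw; exists l, k.
  by rewrite -opprB e opprB.
have pos_take u v : w = u ++ v -> wdeg u \in pos.
  move=> wE; apply/mapP; exists (size u); last by rewrite wE take_size_cat.
  by rewrite mem_iota ltnS wE size_cat leq_addr.
have /codomP[i iE] : inT T (c + 0) by apply: cP; rewrite -(wdeg_nil G) (pos_take _ w).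
rewrite addr0 in iE; exists i; apply/allP => e /mem_traceP[u [v [wE e2]]].
rewrite /vedge e2 -iE; apply/andP; split; first exact/cP/(pos_take _ _ wE).
rewrite -addrA; apply: cP; have := pos_take (rcons u e.1) v.
by rewrite -cats1 wdeg_cat wdeg_cons wdeg_nil addr0 -catA; apply.
Qed.

(** Row [i] of a generic evaluation is a polynomial in the edge parameters whose monomials are the
    traces of the walks from [T i] that stay in T; its coefficients must vanish. *)
Lemma elem_ids_trace_class i p w :
  TG_ids (elem_grading T) p -> vwalk T i w ->
  \sum_(m <- p | perm_eq (trace (T i) m.2) (trace (T i) w)) m.1 = 0.
Proof.
move=> idp vw.
apply: etrans (@monomials_separate F _ [seq (m.1, trace (T i) m.2) | m <- p]
  (fun m => all (vedge T) m.2) F_char0 _ (trace (T i) w)); rewrite ?big_map /=.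
  apply: eq_bigl => m; have [pe|] := boolP (perm_eq _ _); rewrite ?andbF // andbT.
  by rewrite (perm_all _ pe) -/(vwalk T i w) vw.
move=> t; rewrite big_map /=.
have /matrixP e := idp _ (gen_subst_mem T t).
transitivity (\sum_j (geval (gen_subst T t) p) i j); last first.
  by rewrite big1 // => j _; rewrite e mxE.
transitivity (\sum_j \sum_(m <- p) (m.1 *: \prod_(x <- m.2) gen_subst T t x : 'M[F]_4) i j); last first.
  apply: eq_bigr => j _. exact/esym/summxE.
rewrite exchange_big /= big_mkcond; apply: eq_bigr => m _ /=.
transitivity (m.1 * \sum_j (\prod_(x <- m.2) gen_subst T t x) i j).
  by rewrite gen_subst_row // /vwalk; case: ifP; rewrite ?mulr0.
by rewrite mulr_sumr; apply: eq_bigr => j _; rewrite [RHS]mxE.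
Qed.

Theorem elem_grading_basis : TG_generated (gens_11 (elem_grading T)) (TG_ids (elem_grading (F := F) T)).
Proof.
have idsI : TG_ideal (TG_ids (elem_grading (F := F) T)).
  by apply: TG_ideal_ids => [|*]; [apply: elem_grading1 | apply: elem_gradingM].
split=> //; first exact: elem_grading_gens.
move=> J idJ genJ p idp.
(* Intersecting with the identities ensures that what remains after subtracting a member of [I] is
   again an identity, as the induction on the number of terms requires. *)
pose I p := J p /\ TG_ids (elem_grading T) p.
have idI : TG_ideal I by apply: TG_ideal_capl.
have genI q : gens_11 (elem_grading T) q -> I q.
  by move=> gq; split; [apply: genJ | apply: elem_grading_gens].
suff : I p by case.
have [[I0 Ieqv] Iadd Iscale _ _] := idI.
have [_ idsD idsZ _ _] := idsI; have [[_ ids_eqv] _ _ _ _] := idsI.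
have [n] := ubnP (size p); elim: n p idp => // n IH [//|[c w] p] idp /= lt_pn.
have split_ids q r : I q -> gpoly_eqv ((c, w) :: p) (gadd q r) -> (size r < n)%N ->
  I ((c, w) :: p).
  move=> Iq e rn; apply: (Ieqv (gadd q r)); first by move=> v; rewrite e.
  apply: Iadd => //; apply: IH => //.
  apply: (ids_eqv (gadd ((c, w) :: p) (gscale (-1) q))).
    by move=> v; rewrite gcoef_add gcoef_scale e gcoef_add mulN1r addrAC subrr add0r.
  by apply: idsD => //; apply: idsZ; case: Iq.
have [[i vw]|[u [v [v' [wE R0]]]]] := vwalk_or_subword w; last first.
  apply: (split_ids (gscale c (gmono F w)) p) => //.
    apply: Iscale; rewrite wE; apply: ideal_word_ctx => //.
    exact: ideal_word_support R0.
  by move=> x; rewrite gcoef_add gcoef_cons gcoef_scale gcoef_cons gcoef0 /= addr0;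
     case: ifP; rewrite ?mulr1 ?mulr0.
pose cls (m : F * seq (gvar G)) := perm_eq (trace (T i) m.2) (trace (T i) w).
(* All words of the class of [w] are congruent to [w], so that part of the polynomial reduces to its
   coefficient sum times [w], and this sum is 0. *)
have Isum q : all cls q -> I (gsub q (gscale (\sum_(m <- q) m.1) (gmono F w))).
  elim: q => [_|m q IHq /= /andP[mw /IHq Iq]].
    by apply: Ieqv I0 => v; rewrite gcoef_sub gcoef_scale big_nil mul0r subr0.
  have := Iscale m.1 _ (trace_gcong idI genI mw).
  move=> /(Iadd _ _ Iq); apply: Ieqv => v.
  rewrite !(gcoef_add, gcoef_scale, gcoef_cons) !gcoef0 big_cons /=.
  have -> : (if m.2 == v then m.1 else 0) = m.1 * (if m.2 == v then 1 else 0).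
    by case: ifP; rewrite ?mulr1 ?mulr0.
  by rewrite !addr0; case: (w == v); case: (m.2 == v); ring.
apply: (split_ids (filter cls ((c, w) :: p)) (filter (predC cls) ((c, w) :: p))).
- have := Isum _ (filter_all cls ((c, w) :: p)).
  apply: Ieqv => v; rewrite gcoef_sub gcoef_scale big_filter.
  by rewrite (elem_ids_trace_class idp vw) mul0r subr0.
- move=> v; rewrite gcoef_add /gcoef !big_filter.
  by rewrite (bigID cls).
rewrite /= {1}/cls /= perm_refl /=.
by apply: (@leq_ltn_trans (size p)); rewrite // size_filter count_size.
Qed.

End ElementaryBasis.

(* The elementary grading by S satisfies the generators for T, but not the monomial whose
   walk runs through S_0, ..., S_3; so that walk must also be possible in T. *)
Lemma basis_translate (G : zmodType) (F : fieldType) (T S : 'I_4 -> G) :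
  TG_generated (gens_11 (elem_grading T)) (TG_ids (elem_grading (F := F) T)) ->
  injective S -> (forall i j, exists k l, S j - S i = T l - T k) ->
  exists f : 'I_4 -> 'I_4, forall i, S i - S ord0 = T (f i) - T (f ord0).
Proof.
move=> [_ _ gen] S_inj ST.
have [/existsP[f /forallP fP]|/existsPn nf] :=
  boolP [exists f : {ffun 'I_4 -> 'I_4}, [forall i, S i - S ord0 == T (f i) - T (f ord0)]].
  by exists f => i; apply/eqP.
exfalso.
(* The letter that steps from [S_n] to [S_(n+1)]; the index [n] makes the letters distinct. *)
pose x (n : nat) : gvar G := (S (inord n.+1) - S (inord n), n).
pose w := [:: x 0%N; x 1%N; x 2%N].
(* A nonzero term in an entry of the product would pass through indices [p], [k1], [k2], [q], and
   these would define the excluded map [f]. *)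
have idw : TG_ids (elem_grading T) (gmono F w).
  move=> s sT; rewrite geval_mono !big_cons big_nil mulr1; apply/matrixP => p q.
  rewrite [RHS]mxE mxE big1 // => k1 _; rewrite mxE mulr_sumr big1 // => k2 _.
  apply/eqP; apply: contraT; rewrite !mulf_eq0 !negb_or => /and3P[].
  move=> /(iffLR (mem_elem_grading _ _ _) (sT (x 0%N))) e0.
  move=> /(iffLR (mem_elem_grading _ _ _) (sT (x 1%N))) e1.
  move=> /(iffLR (mem_elem_grading _ _ _) (sT (x 2%N))) e2.
  move: (nf [ffun i : 'I_4 => nth q [:: p; k1; k2] i]); rewrite negb_forall => /existsP[i].
  rewrite !ffunE -[i]inord_val.
  have -> : ord0 = inord 0 :> 'I_4 by apply: val_inj; rewrite /= inordK.
  rewrite /gdeg /= in e0 e1 e2.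
  have e01 : T k2 - T p = S (inord 2) - S (inord 0).
    by rewrite -(subrKA (T k1)) e0 e1 subrKA.
  have e02 : T q - T p = S (inord 3) - S (inord 0).
    by rewrite -(subrKA (T k2)) e01 e2 subrKA.
  case: (i : nat) (ltn_ord i) => [|[|[|[|//]]]] _; rewrite !inordK //=.
  - by rewrite !subrr eqxx.
  - by rewrite e0 eqxx.
  - by rewrite e01 eqxx.
  - by rewrite e02 eqxx.
have idI : TG_ideal (TG_ids (elem_grading (F := F) S)).
  by apply: TG_ideal_ids => [|*]; [apply: elem_grading1 | apply: elem_gradingM].
(* Only (iii) depends on the grading, and a degree outside T - T is outside S - S. *)
have genS p : gens_11 (elem_grading T) p -> TG_ids (elem_grading (F := F) S) p.
  move=> gp; apply: (elem_grading_gens S_inj).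
  case: gp => [?|[?|[y [R0 ->]]]]; [by left|by right; left|right; right].
  exists y; split=> //; apply/eqP; apply: contraT => /eqP/elem_grading_neq0[i [j yE]].
  have [k [l e]] := ST i j.
  by have := elem_grading_eq0 k l R0; rewrite yE e eqxx.
(* The three letters become consecutive matrix units with nonzero product. For a large index [inord]
   defaults to [ord0] in the degree and in the matrix unit alike, so the values remain homogeneous
   of the right degree. *)
pose s (y : gvar G) : 'M[F]_4 :=
  if y == x y.2 then delta_mx (inord y.2) (inord y.2.+1) else 0.
have /(_ s) := gen _ idI genS _ idw.
rewrite geval_mono !big_cons big_nil mulr1 /s !eqxx /=.
rewrite -!mulmxE !mul_delta_mx => /(_ _)/matrixP/(_ (inord 0) (inord 3)).
rewrite !mxE !eqxx => H; have /eqP := oner_eq0 F; case; apply: H => y.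
case: ifP => [/eqP yE|_]; last exact: mem0v.
apply/mem_elem_grading => p q; rewrite mxE {3}yE.
by have [->|_] := eqVneq p _; have [->|_] := eqVneq q _; rewrite ?eqxx.
Qed.

(** * Ordered groups and difference sets *)

Section OrderedGroup.
Variables (G : zmodType) (le : rel G).
Hypothesis leG : ordered_group le.
Implicit Types (a b x y : G).

Lemma og_le_refl x : le x x. Proof. by case: leG. Qed.
Lemma og_le_anti x y : le x y -> le y x -> x = y.
Proof. by case: leG => _ anti _ _ _ xy yx; apply: anti; rewrite xy. Qed.
Lemma og_le_trans y x z : le x y -> le y z -> le x z.
Proof. by case: leG => _ _ tr _ _; apply: tr. Qed.
Lemma og_le_total x y : le x y || le y x.
Proof. by case: leG => _ _ _ tot _; apply: tot. Qed.
Lemma og_le_add2r z x y : le (x + z) (y + z) = le x y.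
Proof.
case: leG => _ _ _ _ leD; apply/idP/idP => [/leD|/leD//].
by move=> /(_ (- z)); rewrite !addrK.
Qed.
Lemma og_subr_ge0 x y : le 0 (y - x) = le x y.
Proof. by rewrite -(og_le_add2r x) add0r subrK. Qed.

Lemma gposD x y : gpos le x -> gpos le y -> gpos le (x + y).
Proof.
move=> /andP[x0 xn] /andP[y0 yn]; apply/andP; split.
  by apply: og_le_trans x0 _; rewrite -{1}[x]add0r [x + y]addrC og_le_add2r.
apply: contraNneq xn => xy0; apply/eqP/og_le_anti => //.
by rewrite -(og_le_add2r y) xy0 add0r.
Qed.

Lemma gposN x : gpos le x -> ~~ le 0 (- x).
Proof.
move=> /andP[x0 xn]; apply: contraNN xn => nx; apply/eqP/og_le_anti => //.
by rewrite -(og_le_add2r (- x)) subrr add0r.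
Qed.

Lemma gpos_sub x y : gpos le (y - x) = le x y && (x != y).
Proof. by rewrite /gpos og_subr_ge0 subr_eq0 [y == x]eq_sym. Qed.

Lemma gpos_total x : x != 0 -> gpos le x || gpos le (- x).
Proof.
move=> x0; rewrite /gpos oppr_eq0 x0 !andbT.
have -> : le 0 (- x) = le x 0 by rewrite -(og_le_add2r x) add0r addNr.
exact: og_le_total.
Qed.

Lemma gposMn x n : gpos le x -> gpos le (x *+ n.+1).
Proof. by move=> x0; elim: n => // n IH; rewrite mulrS gposD. Qed.

(** Ordered groups are torsion-free: positive multiples of a positive element are positive. *)
Lemma og_mulrn_eq0 x n : x *+ n.+1 = 0 -> x = 0.
Proof.
move=> xn; apply/eqP; apply: contraT => /gpos_total/orP[] /(gposMn n)/andP[_].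
  by rewrite xn eqxx.
by rewrite mulNrn xn oppr0 eqxx.
Qed.

(** * Differences of the degrees 0, a, a + b, 2a + b *)

Section TwoGenerators.
Variables a b : G.
Hypotheses (a0 : gpos le a) (b0 : gpos le b).

(** Integer coordinates turn comparisons of degrees into computations with coefficient pairs. *)
Definition zcomb (i j : int) : G := a *~ i + b *~ j.

Lemma zcombB i j k l : zcomb i j - zcomb k l = zcomb (i - k) (j - l).
Proof. by rewrite /zcomb !mulrzBr opprD addrACA. Qed.

Lemma zcombN i j : - zcomb i j = zcomb (- i) (- j).
Proof. by rewrite /zcomb !mulrNz opprD. Qed.

Lemma zcomb_gpos (i j : nat) : (0 < i + j)%N -> gpos le (zcomb i j).
Proof.
rewrite /zcomb; case: i j => [|i] [|j] // _; rewrite -!pmulrn ?mulr0n ?add0r ?addr0.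
- exact: gposMn.
- exact: gposMn.
by apply: gposD; apply: gposMn.
Qed.

Definition coord4 (i : 'I_4) : int * int := nth (0, 0) [:: (0, 0); (1, 0); (1, 1); (2, 1)] i.

Lemma seq4_zcomb i : seq4 a b i = zcomb (coord4 i).1 (coord4 i).2.
Proof.
case: i => [[|[|[|[|//]]]]] i4; rewrite /seq4 /coord4 /zcomb /= ?mulr0z ?mulr1z ?addr0 //.
Qed.

Lemma seq4_sub i j : seq4 a b j - seq4 a b i =
  zcomb ((coord4 j).1 - (coord4 i).1) ((coord4 j).2 - (coord4 i).2).
Proof. by rewrite !seq4_zcomb zcombB. Qed.

Hypotheses (ab2 : a != b *+ 2) (ba2 : a *+ 2 != b).

Section Distinct.
Hypothesis ab : a != b.

(* Coefficient pairs of combinations of a and b that cannot vanish: those with nonnegative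
   entries by positivity, the last three by the hypotheses on a and b. *)
Definition never0 (d : int * int) : bool :=
  d \in [:: (1, 0); (2, 0); (3, 0); (0, 1); (0, 2); (1, 1); (2, 1); (3, 1); (2, 2); (1, 2); (4, 1); (4, 2); (1, -2); (2, -1); (1, -1)].

Lemma never0P d : never0 d -> zcomb d.1 d.2 != 0.
Proof.
rewrite /never0 !inE => /orP[/eqP->|]; first by have /andP[] := @zcomb_gpos 1 0 isT.
repeat (case/orP => [/eqP->|]; first by
  match goal with |- is_true (zcomb ?p.1 ?p.2 != 0) => 
    have /andP[] := @zcomb_gpos (absz p.1) (absz p.2) isT end).
case/or3P => /eqP->.
- by rewrite /zcomb /= mulr1z mulrNz subr_eq0.
- by rewrite /zcomb /= mulrN1z subr_eq0.
by rewrite /zcomb /= mulr1z mulrN1z subr_eq0.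
Qed.

Definition in_diff (x : G) := exists i j, x = seq4 a b j - seq4 a b i.

(** Compares the element with each of the sixteen differences; the premise is a finite test on
    coefficients, settled by evaluation. *)
Lemma in_diff_zcomb (k l : int) :
  (forall i j : 'I_4, let d := (k - ((coord4 j).1 - (coord4 i).1), l - ((coord4 j).2 - (coord4 i).2)) in
     never0 d || never0 (- d.1, - d.2)) -> ~ in_diff (zcomb k l).
Proof.
move=> H [i [j /eqP]]; rewrite seq4_sub -subr_eq0 zcombB.
case/orP: (H i j) => [/never0P/negPf->//|/never0P /=].
by rewrite -zcombN oppr_eq0 => /negPf->.
Qed.

Lemma not_in_diff_sub : ~ in_diff (a - b).
Proof.
have -> : a - b = zcomb 1 (- 1) by rewrite /zcomb mulr1z mulrN1z.
apply: in_diff_zcomb => i j.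
by case: i => [[|[|[|[|//]]]]] ?; case: j => [[|[|[|[|//]]]]] ?.
Qed.

Lemma not_in_diff_double : ~ in_diff (a *+ 2).
Proof.
have -> : a *+ 2 = zcomb 2 0 by rewrite /zcomb mulr0z addr0.
apply: in_diff_zcomb => i j.
by case: i => [[|[|[|[|//]]]]] ?; case: j => [[|[|[|[|//]]]]] ?.
Qed.

End Distinct.

(** Up to sign every difference has coordinates in [L], and these represent 0 or a positive element;
    so the condition on [x] determines the sign. *)
Lemma in_diff_ge0 x : in_diff x -> le 0 x -> x \in [:: 0; a; b; a + b; a *+ 2 + b].
Proof.
pose L : seq (int * int) := [:: (0, 0); (1, 0); (0, 1); (1, 1); (2, 1)].
have LP d : d \in L -> zcomb d.1 d.2 \in [:: 0; a; b; a + b; a *+ 2 + b].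
  rewrite !inE /zcomb => /or4P[/eqP->|/eqP->|/eqP->|/orP[]/eqP->];
    by rewrite /= ?mulr0z ?mulr1z ?addr0 ?add0r eqxx ?orbT.
have Lpos d : d \in L -> (zcomb d.1 d.2 == 0) || gpos le (zcomb d.1 d.2).
  rewrite !inE => /or4P[/eqP->|/eqP->|/eqP->|/orP[]/eqP->].
  - by rewrite /zcomb /= !mulr0z addr0 eqxx.
  - by rewrite (@zcomb_gpos 1 0) ?orbT.
  - by rewrite (@zcomb_gpos 0 1) ?orbT.
  - by rewrite (@zcomb_gpos 1 1) ?orbT.
  - by rewrite (@zcomb_gpos 2 1) ?orbT.
move=> [i [j ->]]; rewrite seq4_sub; set k := _ - _; set l := _ - _.
have : ((k, l) \in L) || ((- k, - l) \in L).
  by rewrite /k /l; case: i {k l} => [[|[|[|[|//]]]]] ?; case: j => [[|[|[|[|//]]]]] ?.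
case/orP => [/LP //|/Lpos /=]; rewrite -zcombN oppr_eq0 => /orP[/eqP->|/gposN].
  by rewrite inE eqxx.
by rewrite opprK => /negPf->.
Qed.

Lemma seq4_inj : injective (seq4 a b).
Proof.
suff H (i j : 'I_4) : (i < j)%N -> seq4 a b i != seq4 a b j.
  move=> i j /eqP e; apply: val_inj; apply/eqP; apply: contraLR e.
  by rewrite neq_ltn => /orP[/H|/H]; rewrite // eq_sym.
have p n m : (0 < n + m)%N -> zcomb n%:Z m%:Z != 0.
  by move=> /zcomb_gpos/andP[].
rewrite -subr_eq0 -opprB oppr_eq0 seq4_sub.
case: i => [[|[|[|[|//]]]]] ?; case: j => [[|[|[|[|//]]]]] ? // _;
  by [apply: (p 1 0)|apply: (p 0 1)|apply: (p 1 1)|apply: (p 2 1)].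
Qed.

Lemma seq_min (S : seq G) : S != [::] -> exists2 m, m \in S & forall s, s \in S -> le m s.
Proof.
elim: S => // x [|y S] IH _.
  by exists x => [|s]; rewrite inE ?eqxx // => /eqP->; apply: og_le_refl.
have [//|m mS mle] := IH; case/orP: (og_le_total x m) => xm.
  exists x; first by rewrite inE eqxx.
  by move=> s; rewrite inE => /orP[/eqP->|/mle]; [apply: og_le_refl|apply: og_le_trans].
exists m; first by rewrite inE mS orbT.
by move=> s; rewrite inE => /orP[/eqP->|/mle].
Qed.

(* If S - S lies in T - T for T = {0, a, a + b, 2a + b}, put m = min S; then
   S - m lies in {0, a, b, a + b, 2a + b}, and in T unless it contains b, in which
   case (for a != b) it contains neither a nor 2a + b, hence lies in T - a. *)
Lemma seq4_sets (S : seq G) :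
  (forall s s', s \in S -> s' \in S -> in_diff (s' - s)) ->
  exists c, forall s, s \in S -> inT (seq4 a b) (c + s).
Proof.
move=> SD; have [->|S0] := eqVneq S [::]; first by exists 0.
have [m mS mle] := seq_min S0.
have inS s : s \in S -> s - m \in [:: 0; a; b; a + b; a *+ 2 + b].
  by move=> sS; apply: in_diff_ge0; [apply: SD | rewrite og_subr_ge0 // mle].
have codomT (k : nat) (k4 : (k < 4)%N) x : x = seq4 a b (Ordinal k4) -> inT (seq4 a b) x.
  by move=> ->; apply: codom_f.
have [bS|bS] := boolP ((a != b) && has (fun x => x - m == b) S); last first.
  exists (- m) => s sS; rewrite addrC.
  have := inS _ sS; rewrite !inE => /or4P[/eqP->|/eqP->|/eqP sb|/orP[/eqP->|/eqP->]].
  - exact: (@codomT 0).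
  - exact: (@codomT 1).
  (* Here [s - m = b], so [bS] leaves only the case a = b, where b is the second degree of T. *)
  - apply: (@codomT 1) => //; rewrite /seq4 /= sb.
    by apply/eqP; apply: contraNT bS; rewrite eq_sym => ->; apply/hasP; exists s; rewrite ?sb.
  - exact: (@codomT 2).
  - exact: (@codomT 3).
have /andP[ab /hasP[x xS /eqP xb]] := bS.
exists (a - m) => s sS.
have sx : in_diff (s - m - b) by rewrite -xb opprB addrA subrK; apply: SD.
rewrite addrAC -addrA.
move: (inS _ sS); rewrite !inE => /or4P[/eqP sE|/eqP sE|/eqP sE|/orP[/eqP sE|/eqP sE]];
  rewrite sE in sx *.
- by apply: (@codomT 1); rewrite // addr0.
- by case: (not_in_diff_sub ab).
- exact: (@codomT 2).
- by apply: (@codomT 3); rewrite // /seq4 /= mulr2n addrA.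
by rewrite addrK in sx; case: (not_in_diff_double ab).
Qed.

End TwoGenerators.

Lemma ord4_ind (P : 'I_4 -> Prop) :
  P ord0 -> P (@Ordinal 4 1 isT) -> P (@Ordinal 4 2 isT) -> P (@Ordinal 4 3 isT) -> forall i, P i.
Proof.
move=> P0 P1 P2 P3 [[|[|[|[|//]]]]] i4; 
  [move: P0|move: P1|move: P2|move: P3]; congr (P _); exact: val_inj.
Qed.

Lemma ord4_incr_id (f : 'I_4 -> 'I_4) : (forall i j : 'I_4, (i < j)%N -> (f i < f j)%N) ->
  forall i, f i = i.
Proof.
move=> f_mono i; apply: val_inj.
have h01 := f_mono ord0 (@Ordinal 4 1 isT) isT.
have h12 := f_mono (@Ordinal 4 1 isT) (@Ordinal 4 2 isT) isT.
have h23 := f_mono (@Ordinal 4 2 isT) (@Ordinal 4 3 isT) isT.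
have h4 := ltn_ord (f (@Ordinal 4 3 isT)).
elim/ord4_ind: i => /=; lia.
Qed.

(** * Increasing degree sequences for which the generators suffice *)

Section Sorted.
Variables (F : fieldType) (T : 'I_4 -> G).
Hypothesis T_sorted : forall i j : 'I_4, (i < j)%N -> gpos le (T j - T i).
Hypothesis T_basis :
  TG_generated (gens_11 (elem_grading T)) (TG_ids (elem_grading (F := F) T)).

Let sorted_inj (S : 'I_4 -> G) :
  (forall i j : 'I_4, (i < j)%N -> gpos le (S j - S i)) -> injective S.
Proof.
move=> SS i j e; apply: val_inj; case: (ltngtP i j) => // /SS; rewrite e subrr;
  by rewrite /gpos eqxx andbF.
Qed.

(** The map [f] given by [basis_translate] preserves the strict order, since both sequences
    increase, and hence is the identity on four indices. *)
Lemma sorted_translate (S : 'I_4 -> G) :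
  (forall i j : 'I_4, (i < j)%N -> gpos le (S j - S i)) ->
  (forall i j, exists k l, S j - S i = T l - T k) ->
  forall i, S i - S ord0 = T i - T ord0.
Proof.
move=> SS ST; have [f fP] := basis_translate T_basis (sorted_inj SS) ST.
have fS i j : S j - S i = T (f j) - T (f i).
  transitivity ((S j - S ord0) - (S i - S ord0)); first by rewrite opprB subrKA.
  by rewrite !fP opprB subrKA.
suff /ord4_incr_id f_id : forall i j : 'I_4, (i < j)%N -> (f i < f j)%N.
  by move=> i; rewrite fP !f_id.
move=> i j /SS; rewrite fS; case: ltngtP => // [/T_sorted|/val_inj ->].
  by move=> /gposN + /andP[ge0 _]; rewrite opprB ge0.
by rewrite subrr /gpos eqxx andbF.
Qed.

Local Notation o1 := (@Ordinal 4 1 isT).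
Local Notation o2 := (@Ordinal 4 2 isT).
Local Notation o3 := (@Ordinal 4 3 isT).

(** The sequence -T in increasing order has the same differences as T, hence is a translate of T;
    comparing first gaps gives the equality. *)
Lemma sorted_symmetric : T o3 - T o2 = T o1 - T ord0.
Proof.
pose S i := - T (rev_ord i).
have SB i j : S j - S i = T (rev_ord i) - T (rev_ord j) by rewrite /S opprK addrC.
have := @sorted_translate S _ _ o1; rewrite SB => <-.
- by congr (T _ - T _); apply: val_inj.
- move=> i j ij; rewrite SB; apply: T_sorted => /=.
  by have := ltn_ord j; lia.
by move=> i j; exists (rev_ord j), (rev_ord i).
Qed.

Lemma sorted_diff i j :
  T j - T i = seq4 (T o1 - T ord0) (T o2 - T o1) j - seq4 (T o1 - T ord0) (T o2 - T o1) i.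
Proof.
suff H k : T k = T ord0 + seq4 (T o1 - T ord0) (T o2 - T o1) k.
  by rewrite (H i) (H j) opprD addrACA subrr add0r.
have e2 : T o2 = T ord0 + (T o1 - T ord0 + (T o2 - T o1)).
  by rewrite addrA [T ord0 + _]addrC !subrK addrC subrK.
elim/ord4_ind: k; rewrite /seq4 /=.
- by rewrite addr0.
- by rewrite addrC subrK.
- exact: e2.
rewrite mulr2n -addrA addrCA -e2 -sorted_symmetric.
by rewrite subrK.
Qed.

Lemma arith_sorted c : gpos le c ->
  forall i j : 'I_4, (i < j)%N -> gpos le (c *+ j - c *+ i).
Proof.
move=> c0 i j ij; rewrite -mulrnBr 1?ltnW // -(subnSK ij).
exact: gposMn.
Qed.

(** Differences of 0, c, 2c, 3c are, up to sign, multiples nc with n < 4, so [sorted_translate]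
    applies to this progression. *)
Lemma sorted_no_progression c : gpos le c ->
  (forall n : 'I_4, exists k l, c *+ n = T l - T k) -> forall i : 'I_4, c *+ i = T i - T ord0.
Proof.
move=> c0 cT i; rewrite -[c *+ i]subr0 -(mulr0n c) -[0%N]/(nat_of_ord (@ord0 3)).
apply: (sorted_translate (arith_sorted c0)) => {}i j.
case: (leqP i j) => ij.
  rewrite -mulrnBr //; have lt4 : (j - i < 4)%N by rewrite (leq_ltn_trans (leq_subr _ _)).
  exact: (cT (Ordinal lt4)).
rewrite -opprB -mulrnBr 1?ltnW //.
have lt4 : (i - j < 4)%N by rewrite (leq_ltn_trans (leq_subr _ _)).
by have [k [l /= ->]] := cT (Ordinal lt4); exists l, k; rewrite opprB.
Qed.

Lemma sorted_generic : let a := T o1 - T ord0 in let b := T o2 - T o1 in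
  [/\ gpos le a, gpos le b, a != b *+ 2 & a *+ 2 != b].
Proof.
move=> a b; have a0 : gpos le a by apply: T_sorted.
have b0 : gpos le b by apply: T_sorted.
have e32 : T o3 - T o2 = a := sorted_symmetric.
have e20 : T o2 - T ord0 = b + a by rewrite -(subrKA (T o1)).
have e31 : T o3 - T o1 = a + b by rewrite -(subrKA (T o2)) e32.
split=> //; apply/eqP => e.
(* If a = 2b, the multiples 0, b, 2b = a and 3b = a + b are differences of T, so the first gap a
   would equal b, forcing b = 0. *)
- have := @sorted_no_progression b b0 _ o1; rewrite -/a e => /(_ _)/eqP.
  rewrite mulr1n mulr2n -subr_eq0 opprD addrA subrr sub0r oppr_eq0 => h.
  move: (b0) => /andP[_ /negP]; apply; apply: h; case=> [[|[|[|[|//]]]]] ? /=.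
  + by exists o1, o1; rewrite subrr.
  + by exists o1, o2.
  + by exists ord0, o1; rewrite -/a e.
  by exists ord0, o2; rewrite e20 e mulrS.
(* If b = 2a, the multiples 0, a, 2a = b and 3a = a + b are differences of T, so
   [T o2 - T ord0 = 3a] would equal 2a, forcing a = 0. *)
have := @sorted_no_progression a a0 _ o2; rewrite e20 -e -mulrSr => /(_ _)/eqP.
rewrite [_ *+ 3]mulrS -subr_eq0 opprD addrCA subrr addr0 oppr_eq0 => h.
move: (a0) => /andP[_ /negP]; apply; apply: h; case=> [[|[|[|[|//]]]]] ? /=.
+ by exists o1, o1; rewrite subrr.
+ by exists ord0, o1.
+ by exists o1, o2; rewrite -/b e.
by exists ord0, o2; rewrite e20 -e -mulrSr.
Qed.

End Sorted.
End OrderedGroup.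

(** * Gradings are elementary *)

(** All eigenvalues vanish, so the characteristic polynomial is a power of X, and the trace is minus
    its subleading coefficient. *)
Lemma mxtrace_nilp (F : closedFieldType) (n : nat) (x : 'M[F]_n.+1) k : x ^+ k = 0 -> \tr x = 0.
Proof.
move=> xk; have [rs rsE] := closed_field_poly_normal (char_poly x).
rewrite (monicP (char_poly_monic x)) scale1r in rsE.
have rs0 r : r \in rs -> r = 0.
  rewrite -root_prod_XsubC -rsE -eigenvalue_root_char => /eigenvalueP[v vx v0].
  have vxk : v *m x ^+ k = r ^+ k *: v.
    elim: k {xk} => [|k IH]; first by rewrite !expr0 mulmx1 scale1r.
    by rewrite exprSr -mulmxE mulmxA IH -scalemxAl vx scalerA exprSr.
  move: vxk; rewrite xk mulmx0 => /esym/eqP; rewrite scaler_eq0 (negPf v0) orbF.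
  by rewrite expf_eq0 => /andP[_ /eqP].
have rsX : char_poly x = 'X^(size rs).
  rewrite rsE (eq_big_seq (fun=> 'X)) => [|r /rs0 ->]; last by rewrite subr0.
  by rewrite big_const_seq count_predT iter_mulr_1.
have szrs : size rs = n.+1.
  by have := size_char_poly x; rewrite rsX size_polyXn => -[].
apply/eqP; rewrite -oppr_eq0 -char_poly_trace // rsX szrs coefXn /=.
by rewrite ltn_eqF.
Qed.

Lemma mxtrace_mul_delta (F : fieldType) (n : nat) (x : 'M[F]_n) i j :
  \tr (x *m delta_mx j i) = x i j.
Proof.
rewrite /mxtrace (bigD1 i) //= [X in _ + X]big1 ?addr0 => [|k ki].
  rewrite mxE (bigD1 j) //= [X in _ + X]big1 ?addr0 => [|l lj]; rewrite mxE ?eqxx ?mulr1 //.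
  by rewrite (negPf lj) mulr0.
by rewrite mxE big1 // => l _; rewrite mxE (negPf ki) andbF mulr0.
Qed.

Lemma mx_scaleE (F : fieldType) m n (a : F) (x : 'M[F]_(m, n)) i j : (a *: x) i j = a * x i j.
Proof. by rewrite mxE. Qed.

Lemma mx_subE (F : fieldType) m n (x y : 'M[F]_(m, n)) i j : (x - y) i j = x i j - y i j.
Proof. by rewrite !mxE. Qed.

Lemma mx_one_diagE (F : fieldType) n i : (1 : 'M[F]_n.+1) i i = 1.
Proof. by rewrite mxE eqxx. Qed.

(** The innermost factor [r * y] collapses to [c *: e] at each stage. Thus a nilpotent [r] forces c
    = 0 when [e] is nonzero. *)
Lemma exp_scale_idem (F : fieldType) (A : algType F) (r y e : A) (c : F) :
  r * e = r -> e * y = y -> r * y = c *: e -> forall m, r ^+ m * e * y ^+ m = c ^+ m *: e.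
Proof.
move=> re ey ry; elim=> [|m IH]; first by rewrite !expr0 mul1r mulr1 scale1r.
rewrite exprSr exprS -!mulrA [r * _]mulrA re [r * _]mulrA ry.
by rewrite -scalerAl -scalerAr mulrA IH scalerA exprS.
Qed.

(** * Conjugation as an algebra automorphism *)

Section Conjugation.
Variables (F : fieldType) (n : nat).
Implicit Types P x : 'M[F]_n.+1.

(** The proof of invertibility is an argument so that the morphism instance, whose multiplicativity
    needs it, can be inferred from the term. *)
Definition conjr P (uP : P \is a GRing.unit) x := P * x * P^-1.

Fact conjr_is_linear P uP : linear (@conjr P uP).
Proof. by move=> a x y; rewrite /conjr mulrDr mulrDl -scalerAr -scalerAl. Qed.

Fact conjr_is_monoid_morphism P uP : monoid_morphism (@conjr P uP).
Proof.
split=> [|x y]; rewrite /conjr; first by rewrite mulr1 divrr.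
by rewrite !mulrA divrK.
Qed.

HB.instance Definition _ P uP :=
  GRing.isLinear.Build F 'M[F]_n.+1 'M[F]_n.+1 *:%R (@conjr P uP) (@conjr_is_linear P uP).
HB.instance Definition _ P uP :=
  GRing.isMonoidMorphism.Build 'M[F]_n.+1 'M[F]_n.+1 (@conjr P uP) (@conjr_is_monoid_morphism P uP).

Lemma conjrK P uP : cancel (@conjr P uP) (fun x => P^-1 * x * P).
Proof. by move=> x; rewrite /conjr -!mulrA mulVr // mulr1 !mulrA mulVr // mul1r. Qed.

Lemma conjrVK P uP : cancel (fun x => P^-1 * x * P) (@conjr P uP).
Proof. by move=> x; rewrite /conjr !mulrA divrr // mul1r -mulrA divrr // mulr1. Qed.

End Conjugation.

Section Grading.
Variables (G : zmodType) (le : rel G) (F : closedFieldType).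
Variable R : G -> {vspace 'M[F]_4}.
Hypothesis leG : ordered_group le.
Hypothesis gradR : is_grading R.
Implicit Types (x y z : 'M[F]_4) (g h : G).

Let RM g h x y : x \in R g -> y \in R h -> x * y \in R (g + h).
Proof. by case: gradR => _; apply. Qed.

Lemma grading_decomp : exists2 s0 : seq G, uniq s0 /\ (forall g, g \notin s0 -> R g = 0%VS) &
  forall x, exists2 c : G -> 'M[F]_4, (forall g, c g \in R g) & x = \sum_(g <- s0) c g.
Proof.
case: gradR => -[s0 [us0 sR sumR dirR]] _; exists s0 => // x.
have : x \in (\sum_(g <- s0) R g)%VS by rewrite sumR memvf.
rewrite (big_nth 0) big_mkord => /memv_sumP[c cR ->].
pose d g := if insub (index g s0) is Some i then c i else 0.
exists d => [g|].
  rewrite /d; case: insubP => [i gs iE|]; last by rewrite mem0v.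
  by have := cR i isT; rewrite iE nth_index // -index_mem.
rewrite (big_nth 0) big_mkord; apply: eq_bigr => i _.
by rewrite /d index_uniq // valK.
Qed.

(** Components outside the support [s0] are zero, so the sum can be rewritten over [s0], where
    directness applies. *)
Lemma grading_indep s1 (c : G -> 'M[F]_4) : uniq s1 ->
  (forall g, g \in s1 -> c g \in R g) -> \sum_(g <- s1) c g = 0 ->
  forall g, g \in s1 -> c g = 0.
Proof.
case: gradR => -[s0 [us0 sR sumR dirR]] _ us1 cR c0 g gs1.
have [gs0|/sR R0] := boolP (g \in s0); last by apply/eqP; rewrite -memv0 -R0 cR.
pose d g := if g \in s1 then c g else 0.
have -> : c g = d g by rewrite /d gs1.
have d0 : \sum_(g <- s0) d g = 0.
  rewrite -[RHS]c0 /d -big_mkcond -big_filter [RHS](bigID (mem s0)) /=.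
  rewrite [X in _ = _ + X]big1_seq ?addr0 => [|h /andP[/sR R0 hs1]]; last first.
    by apply/eqP; rewrite -memv0 -R0 cR.
  rewrite -[RHS]big_filter; apply: perm_big; apply: uniq_perm; rewrite ?filter_uniq //.
  by move=> h; rewrite !mem_filter andbC.
rewrite (big_nth 0) big_mkord in d0.
have /directv_sum_independent dir : directv (\sum_(i < size s0) R s0`_i)%VS.
  by move: dirR; rewrite !directvE /= (big_nth 0) big_mkord [X in _ == X](big_nth 0) big_mkord.
have idx : (index g s0 < size s0)%N by rewrite index_mem.
have := dir (fun i => d s0`_i) _ d0 (Ordinal idx) isT.
rewrite /= nth_index //; apply=> i _; rewrite /d.
by case: ifP => [/cR//|_]; apply: mem0v.
Qed.

Lemma homog_disjoint g h x : x \in R g -> x \in R h -> x != 0 -> g = h.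
Proof.
move=> xg xh; apply: contra_neq_eq => gh.
have := @grading_indep [:: g; h] (fun k => if k == g then x else - x).
rewrite /= inE gh => /(_ isT _ _ g); rewrite eqxx inE eqxx; apply=> // [k|].
  by rewrite !inE => /orP[]/eqP->; [rewrite eqxx|case: eqP => [->//|_]; rewrite memvN].
by rewrite !big_cons big_nil eqxx eq_sym (negPf gh) addr0 subrr.
Qed.

(* x = x * 1 for homogeneous x; comparing components shows that the neutral
   component of 1 is a right identity. *)
Lemma grading1 : 1 \in R 0.
Proof.
have [s0 [us0 sR] dec] := grading_decomp.
have [c cR c1] := dec 1.
suff xc x : x * c 0 = x by rewrite -[1](xc 1) mul1r.
have [d dR ->] := dec x; rewrite mulr_suml; apply: eq_big_seq => h _.
pose s1 := undup (h :: [seq h + g | g <- s0]).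
(* The component of degree [k] of [d h * 1 - d h], which is 0; the list [s1] contains [h] even if 0
   is outside the support. *)
pose c' k := d h * c (k - h) - (if k == h then d h else 0).
have hs1 : h \in s1 by rewrite mem_undup inE eqxx.
have := @grading_indep s1 c' (undup_uniq _) _ _ h hs1.
rewrite /c' eqxx subrr => H; apply/eqP; rewrite -subr_eq0; apply/eqP/H => [k _|].
  apply: memvB; first by rewrite -{2}[k](subrK h) [k - h + h]addrC RM.
  by case: eqP => [->//|_]; apply: mem0v.
rewrite sumrB -big_mkcond /=.
rewrite -[X in _ - X]big_filter [X in _ - X](perm_big [:: h]) ?big_seq1; last first.
  apply: uniq_perm; rewrite ?filter_uniq ?undup_uniq // => k; rewrite mem_filter inE.
  by case: eqP => // ->.
rewrite -mulr_sumr [X in d h * X](_ : _ = 1) ?mulr1 ?subrr //.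
rewrite [RHS]c1 (bigID (fun k => k - h \in s0)) /= [X in _ + X]big1 ?addr0; last first.
  by move=> k /sR R0; apply/eqP; rewrite -memv0 -R0.
rewrite -big_filter (perm_big [seq h + g | g <- s0]) ?big_map.
  by apply: eq_bigr => g _; rewrite addrAC subrr add0r.
have inj : injective (fun g => h + g) by apply: addrI.
apply: uniq_perm; rewrite ?filter_uniq ?undup_uniq ?map_inj_uniq // => k.
rewrite mem_filter mem_undup inE; apply/andP/mapP => [[ks _]|[g gs ->]].
  by exists (k - h); rewrite // addrC subrK.
by rewrite addrAC subrr add0r gs map_f ?orbT.
Qed.

Lemma grading_exp g x n : x \in R g -> x ^+ n \in R (g *+ n).
Proof.
move=> xg; elim: n => [|n IH]; first by rewrite expr0 mulr0n grading1.
by rewrite exprS mulrS RM.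
Qed.

(** The positive multiples of [g] are pairwise distinct, so one of them falls outside the finite
    support. *)
Lemma homog_nilp g x : x \in R g -> g != 0 -> exists n, x ^+ n = 0.
Proof.
move=> xg g0; have [s0 [us0 sR] _] := grading_decomp.
have [/allP all_s|/allPn[n _ nS]] := boolP (all (fun n => g *+ n.+1 \in s0) (iota 0 (size s0).+1)).
  have inj : injective (fun n => g *+ n.+1).
    suff H m n : g *+ m.+1 = g *+ (m + n).+1 -> n = 0%N.
      move=> m n; case: (leqP m n) => [mn|/ltnW nm].
        by move=> e; have := H m (n - m)%N; rewrite subnKC // => /(_ e); lia.
      by move=> e; have := H n (m - n)%N; rewrite subnKC // => /(_ (esym e)); lia.
    rewrite -addSn mulrnDr -{1}[g *+ m.+1]addr0 => /addrI/esym; case: n => // n.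
    by move/(og_mulrn_eq0 leG)=> e; rewrite e eqxx in g0.
  have := @uniq_leq_size _ [seq g *+ n.+1 | n <- iota 0 (size s0).+1] s0.
  rewrite map_inj_uniq // iota_uniq size_map size_iota ltnn => /(_ isT) H.
  by suff : false by []; apply: H => _ /mapP[n /all_s ns ->].
exists n.+1; apply/eqP; rewrite -memv0.
by rewrite -(sR _ nS) grading_exp.
Qed.

Lemma homog_trace g x : x \in R g -> g != 0 -> \tr x = 0.
Proof. by move=> xg /(homog_nilp xg)[n]; apply: mxtrace_nilp. Qed.

(** A nonzero entry of [x] is its trace against a matrix unit, and only the component of degree
    [- g] of that unit contributes, by [homog_trace]. *)
Lemma trace_nondeg g x : x \in R g -> x != 0 -> exists2 y, y \in R (- g) & \tr (x * y) != 0.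
Proof.
move=> xg /eqP x0; have [s0 [us0 sR] dec] := grading_decomp.
have [/existsP[i /existsP[j xij]]|/existsPn H] := boolP [exists i, exists j, x i j != 0]; last first.
  case: x0; apply/matrixP => i j; rewrite [RHS]mxE; apply/eqP.
  by apply: contraT => xij; case/existsP: (H i); exists j.
have [c cR dE] := dec (delta_mx j i); exists (c (- g)) => //.
have : \tr (x * delta_mx j i) != 0.
  by rewrite -mulmxE mxtrace_mul_delta.
apply: contraNN => /eqP t0; rewrite dE mulr_sumr raddf_sum big1_seq //= => h _.
have [->//|hg] := eqVneq h (- g).
by apply: (homog_trace (RM xg (cR h))); rewrite addrC addr_eq0.
Qed.

Hypothesis commR : forall x y, x \in R 0 -> y \in R 0 -> x * y = y * x.

(** By commutativity [x * y] is nilpotent for every neutral [y], so [x] is orthogonal to [R 0] under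
    the trace form. *)
Lemma neutral_reduced x n : x \in R 0 -> x ^+ n = 0 -> x = 0.
Proof.
move=> x0 xn; apply/eqP; apply: contraT => /(trace_nondeg x0)[y]; rewrite oppr0 => y0.
have -> : \tr (x * y) = 0; last by rewrite eqxx.
by apply: (@mxtrace_nilp _ _ _ n); rewrite exprMn_comm ?xn ?mul0r //; apply: commR.
Qed.

Lemma neutralM x y : x \in R 0 -> y \in R 0 -> x * y \in R 0.
Proof. by move=> x0 y0; rewrite -(addr0 0) RM. Qed.

Lemma neutral_horner x (p : {poly F}) : x \in R 0 -> horner_mx x p \in R 0.
Proof.
move=> x0; elim/poly_ind: p => [|p c IH]; first by rewrite rmorph0 mem0v.
rewrite rmorphD rmorphM /= horner_mx_X horner_mx_C -[c]mulr1 -scale_scalar_mx.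
by rewrite memvD ?neutralM // rpredZ // grading1.
Qed.

(** Let [q] have the distinct eigenvalues as simple roots. A power of [q] is divisible by the
    characteristic polynomial, so q(x) is nilpotent by Cayley-Hamilton, hence 0, and the minimal
    polynomial divides [q]. *)
Lemma neutral_diagonalizable x : x \in R 0 -> exists2 P : 'M[F]_4, P \in unitmx & similar_diag P x.
Proof.
move=> x0; apply/diagonalizableP.
have [rs rsE] := closed_field_poly_normal (char_poly x).
rewrite (monicP (char_poly_monic x)) scale1r in rsE.
exists (undup rs); first exact: undup_uniq.
set q := \prod_(r <- _) _; apply: mxminpoly_min.
apply: (@neutral_reduced _ (size rs)); first exact: neutral_horner.
suff : char_poly x %| q ^+ size rs.
  by case/dvdpP=> u e; rewrite -rmorphXn /= e rmorphM /= Cayley_Hamilton mulr0.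
rewrite rsE; have : {subset rs <= undup rs} by move=> r; rewrite mem_undup.
rewrite /q; move: (undup rs) => U {q rsE}; elim: rs => [_|r l IH sub]; first by rewrite big_nil dvd1p.
rewrite big_cons exprS dvdp_mul ?IH // => [|r' r'l]; last by rewrite sub // inE r'l orbT.
by rewrite dvdp_XsubCl root_prod_XsubC sub // inE eqxx.
Qed.

Lemma neutral_codiagonalizable : exists2 P : 'M[F]_4, P \is a GRing.unit &
  forall x, x \in R 0 -> forall i j, i != j -> (P * x * P^-1) i j = 0.
Proof.
have [|P uP /allP Pd] := (codiagonalizableP (vbasis (R 0))).1.
  split=> [x y /vbasis_mem x0 /vbasis_mem y0|x /vbasis_mem]; first exact: commR.
  exact: neutral_diagonalizable.
exists P => // x x0 i j ij; rewrite (coord_vbasis x0) mulr_sumr mulr_suml summxE big1 // => k _.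
rewrite -scalerAr -scalerAl mxE.
have kb : (vbasis (R 0))`_k \in vbasis (R 0) by apply: mem_nth; rewrite size_tuple.
have := Pd _ kb; rewrite /= /similar_to conjumx // => /is_diag_mxP.
by move=> /(_ i j ij) e; rewrite [X in _ * X]e mulr0.
Qed.


(** * Homogeneity of the matrix units in a common eigenbasis *)

Section Diagonalized.
Variable P : 'M[F]_4.
Hypothesis uP : P \is a GRing.unit.
Local Notation D := (conjr uP).
Hypothesis diagR : forall x, x \in R 0 -> forall i j, i != j -> D x i j = 0.

Definition munit i j : 'M[F]_4 := P^-1 * delta_mx i j * P.

Lemma conjr_munit i j : D (munit i j) = delta_mx i j.
Proof. exact: conjrVK. Qed.

Lemma munit_mul i j k l : munit i j * munit k l = if j == k then munit i l else 0.
Proof.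
apply: (can_inj (conjrK uP)); rewrite rmorphM /= !conjr_munit -mulmxE mul_delta_mx_cond.
by case: eqP => _; rewrite ?conjr_munit ?mulr1n // mulr0n rmorph0.
Qed.

Lemma munit_neq0 i j : munit i j != 0.
Proof.
apply/eqP => /(congr1 D)/matrixP/(_ i j)/eqP.
by rewrite conjr_munit rmorph0 !mxE !eqxx oner_eq0.
Qed.

Lemma munit_sandwich i j x : munit i i * x * munit j j = D x i j *: munit i j.
Proof.
apply: (can_inj (conjrK uP)); rewrite linearZ 2!rmorphM /= !conjr_munit.
apply/matrixP => k l; rewrite -mulmxE !mxE (bigD1 j) //= [X in _ + X]big1 ?addr0; last first.
  by move=> q qj; rewrite [delta_mx j j _ _]mxE (negPf qj) mulr0.
rewrite !mxE (bigD1 i) //= [X in _ + X]big1 ?addr0; last first.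
  by move=> q qi; rewrite mxE (negPf qi) andbF mul0r.
rewrite !mxE !eqxx andbT /=.
by case: (k == i); case: (l == j); rewrite ?mul0r ?mulr0 ?mul1r ?mulr1.
Qed.

Lemma neutral_diag_mul x y k : x \in R 0 -> D (x * y) k k = D x k k * D y k k.
Proof.
move=> x0; rewrite rmorphM -mulmxE mxE (bigD1 k) //= [X in _ + X]big1 ?addr0 // => l lk.
by rewrite (diagR x0) ?mul0r // eq_sym.
Qed.

Lemma neutral_diag_eq x y : x \in R 0 -> y \in R 0 -> (forall k, D x k k = D y k k) -> x = y.
Proof.
move=> x0 y0 xy; apply: (can_inj (conjrK uP)); apply/matrixP => i j.
by have [->|ij] := eqVneq i j; rewrite ?xy // !diagR.
Qed.

(** Equality of two diagonal characters of [R 0], tested on a basis to be decidable. *)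
Definition chareq i k := all (fun b => D b k k == D b i i) (vbasis (R 0)).

Lemma chareqP i k x : chareq i k -> x \in R 0 -> D x k k = D x i i.
Proof.
move=> /allP ik x0; rewrite (coord_vbasis x0) linear_sum !summxE; apply: eq_bigr => n _.
rewrite linearZ /= !mx_scaleE; congr (_ * _); apply/eqP/ik.
by apply: mem_nth; rewrite size_tuple.
Qed.

(** Interpolation: for each [j] outside the class of [i], an affine function of a separating neutral
    element is 1 on the class and 0 at [j]; multiply these over all [j]. *)
Lemma class_idempotent i : exists2 e, e \in R 0 & forall k, D e k k = (chareq i k)%:R.
Proof.
have sepP j : exists y, y \in R 0 /\ (forall k, chareq i k -> D y k k = 1) /\
    (~~ chareq i j -> D y j j = 0).
  have [ij|/allPn[b bR bij]] := boolP (chareq i j).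
    exists 1; rewrite grading1; split=> //; split=> // k _; rewrite rmorph1 mx_one_diagE //.
  have b0 : b \in R 0 by apply: vbasis_mem.
  exists ((D b i i - D b j j)^-1 *: (b - D b j j *: 1)).
  split; first by rewrite rpredZ // memvB // rpredZ // grading1.
  have E k : D ((D b i i - D b j j)^-1 *: (b - D b j j *: 1)) k k =
      (D b i i - D b j j)^-1 * (D b k k - D b j j).
    by rewrite linearZ linearB /= linearZ rmorph1 /= mx_scaleE mx_subE mx_scaleE mx_one_diagE mulr1.
  split=> [k ik|_]; rewrite E ?subrr ?mulr0 //.
  by rewrite (chareqP ik b0) mulVf // subr_eq0 eq_sym.
have [y yP] := fin_all_exists sepP.
suff [e e0 eP] : exists2 e, e \in R 0 & forall k, D e k k = \prod_(j <- enum 'I_4) D (y j) k k.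
  exists e => // k; rewrite eP; have [ik|ik] := boolP (chareq i k).
    by rewrite big1 // => j _; have [_ [+ _]] := yP j; apply.
  rewrite big_enum (bigD1 k) //=; have [_ [_ ->]] := yP k; by rewrite ?mul0r.
elim: (enum _) => [|j s [e e0 eP]].
  by exists 1; [apply: grading1|move=> k; rewrite big_nil rmorph1 mx_one_diagE].
have [y0 _] := yP j; exists (y j * e); first exact: neutralM.
by move=> k; rewrite big_cons neutral_diag_mul // eP.
Qed.

(* On the corner cut out by a class idempotent e the neutral component is F e, so a
   nonzero homogeneous element there is invertible, hence of degree 0. *)
Lemma chareq_eq i j : chareq i j -> i = j.
Proof.
move=> ij; apply/eqP; apply: contraT => neq_ij.
have [e e0 eP] := class_idempotent i.
have ii : chareq i i by apply/allP => b _; rewrite eqxx.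
have ee : e * e = e.
  apply: neutral_diag_eq => [||k] //; first exact: neutralM.
  by rewrite neutral_diag_mul // eP -natrM mulnb andbb.
have eDE x k l : D (e * x * e) k l = (chareq i k)%:R * D x k l * (chareq i l)%:R.
  rewrite !rmorphM -!mulmxE mxE (bigD1 l) //= [X in _ + X]big1 ?addr0; last first.
    by move=> q ql; rewrite diagR ?mulr0.
  rewrite mxE (bigD1 k) //= [X in _ + X]big1 ?addr0; last first.
    by move=> q ql; rewrite diagR ?mul0r // eq_sym.
  by rewrite !eP.
have [s0 _ dec] := grading_decomp; have [c cR zE] := dec (munit i j).
(* Components of degree 0 are diagonal, so the entry at (i, j) of [e * munit i j * e] must come from
   a component of nonzero degree in the corner. *)
have [/hasP[g _ /andP[g0 r0]]|/hasPn H] :=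
    boolP (has (fun g => (g != 0) && (e * c g * e != 0)) s0); last first.
  have : D (e * munit i j * e) i j = 0.
    rewrite zE mulr_sumr mulr_suml linear_sum summxE big1_seq //= => g gs.
    have := H _ gs; rewrite negb_and !negbK => /orP[/eqP->|/eqP->].
      by apply: diagR => //; rewrite !neutralM.
    by rewrite linear0 mxE.
  by rewrite eDE conjr_munit mxE !eqxx ii ij mulr1 mul1r => /eqP; rewrite oner_eq0.
set r := e * c g * e in r0.
have er : e * r = r by rewrite /r !mulrA ee.
have re : r * e = r by rewrite /r -!mulrA ee.
have rg : r \in R g by rewrite -[g]add0r -[_ + g]addr0 !RM.
have [y yg tr_ry] := trace_nondeg rg r0.
(* Compressing [y] to the corner preserves the trace against [r], so [u] is nonzero; being neutral
   and in the corner, it is a multiple of [e]. *)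
pose y' := e * y * e; have ey : e * y' = y' by rewrite /y' !mulrA ee.
have yg' : y' \in R (- g) by rewrite -[- g]add0r -[_ + - g]addr0 !RM.
pose u := r * y'; have u0 : u \in R 0 by rewrite -(subrr g) RM.
have uN0 : u != 0.
  have tr_u : \tr u = \tr (r * y).
    by rewrite /u /y' !mulrA re -mulmxE mxtrace_mulC mulmxE mulrA er.
  by apply: contraNneq tr_ry => u0'; rewrite -tr_u u0' linear0.
have uE : u = D u i i *: e.
  apply: neutral_diag_eq => [||k] //; first by rewrite rpredZ.
  rewrite linearZ mx_scaleE /= eP.
  have [ik|ik] := boolP (chareq i k); first by rewrite (chareqP ik u0) mulr1.
  have -> : u = e * u by rewrite /u mulrA er.
  by rewrite neutral_diag_mul // eP (negPf ik) mul0r mulr0.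
set cc := D u i i in uE.
have cc0 : cc != 0 by apply: contraNneq uN0 => c0; rewrite uE c0 scale0r.
have [n rn] := homog_nilp rg g0.
have pw := exp_scale_idem re ey uE.
have := pw n; rewrite rn !mul0r => /esym/eqP; rewrite scaler_eq0 expf_eq0 (negPf cc0) andbF /=.
move=> /eqP e00; have := eP i; rewrite e00 linear0 mxE ii => /esym/eqP.
by rewrite oner_eq0.
Qed.

Lemma munit_neutral i : munit i i \in R 0.
Proof.
have [e e0 eP] := class_idempotent i.
suff <- : e = munit i i by [].
apply: (can_inj (conjrK uP)); rewrite conjr_munit; apply/matrixP => k l.
rewrite [RHS]mxE; have [->|kl] := eqVneq k l; last first.
  rewrite diagR //; have [ki|//] := eqVneq k i.
  by rewrite -ki eq_sym (negPf kl).
rewrite eP andbb; congr (nat_of_bool _)%:R; apply/idP/eqP => [/chareq_eq//|->].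
by apply/allP => b _; rewrite eqxx.
Qed.

(** Multiplying a component of [munit i j] by neutral diagonal units on both sides keeps its degree
    and yields a multiple of [munit i j]; some component gives a nonzero one. *)
Lemma munit_homog i j : exists g, munit i j \in R g.
Proof.
have [s0 _ dec] := grading_decomp; have [c cR zE] := dec (munit i j).
have [/hasP[g _ ng]|/hasPn H] := boolP (has (fun g => D (c g) i j != 0) s0).
  exists g; rewrite -[munit i j](scalerK ng) -munit_sandwich rpredZ //.
  by have := RM (RM (munit_neutral i) (cR g)) (munit_neutral j); rewrite add0r addr0.
have /eqP : D (munit i j) i j = 0.
  by rewrite zE linear_sum summxE big1_seq //= => g /H; rewrite negbK => /eqP.
by rewrite conjr_munit mxE !eqxx oner_eq0.
Qed.

(** Take for [T i] the degree of [munit ord0 i]. Then [munit i ord0] has degree [- T i], since the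
    product of the two is neutral. Equal degrees would make an off-diagonal unit neutral, hence
    diagonal. *)
Lemma munit_degrees : exists2 T : 'I_4 -> G, injective T &
  forall i j, munit i j \in R (T j - T i).
Proof.
have [T TP] := fin_all_exists (munit_homog ord0).
have H i : munit i ord0 \in R (- T i).
  have [h hP] := munit_homog i ord0; suff -> : - T i = h by [].
  apply/eqP; rewrite eq_sym -addr_eq0 addrC; apply/eqP.
  apply: (homog_disjoint (RM (TP i) hP)); last by rewrite munit_mul eqxx munit_neq0.
  by rewrite munit_mul eqxx munit_neutral.
have TU i j : munit i j \in R (T j - T i).
  by have := RM (H i) (TP j); rewrite munit_mul eqxx addrC.
exists T => // i j Tij; apply/eqP; apply: contraT => ij.
have := TU i j; rewrite Tij subrr => /diagR/(_ _ _ ij)/eqP.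
by rewrite conjr_munit mxE !eqxx oner_eq0.
Qed.

End Diagonalized.

Lemma iso_of_munits P (T : 'I_4 -> G) : P \is a GRing.unit ->
  (forall i j, munit P i j \in R (T j - T i)) -> iso_gradings R (elem_grading T).
Proof.
move=> uP TU; exists (conjr uP); split.
  by exists (fun x => P^-1 * x * P); [apply: conjrK|apply: conjrVK].
move=> g y; split=> [/mem_elem_grading yg|[x xg ->]].
  exists (P^-1 * y * P); last by rewrite /= conjrVK.
  rewrite [y]matrix_sum_delta mulr_sumr mulr_suml; apply: rpred_sum => i _.
  rewrite mulr_sumr mulr_suml; apply: rpred_sum => j _.
  rewrite -scalerAr -scalerAl; have [->|/yg <-] := eqVneq (y i j) 0.
    by rewrite scale0r mem0v.
  by rewrite rpredZ // -/(munit P i j) TU.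
(* A nonzero coordinate of [x] at (i, j) puts [munit i j] into [R g] as well, which determines
   [g]. *)
apply/mem_elem_grading => i j xij; apply: (homog_disjoint (TU i j)); last exact: munit_neq0.
rewrite -[munit P i j](scalerK xij) -munit_sandwich rpredZ //.
have U0 k : munit P k k \in R 0 by rewrite -(subrr (T k)) TU.
by have := RM (RM (U0 i) xg) (U0 j); rewrite add0r addr0.
Qed.

(** Allows the degrees to be sorted by changing only the conjugating matrix. *)
Lemma munit_perm P (s : 'S_4) i j : P \is a GRing.unit ->
  munit (perm_mx s * P) i j = munit P (s i) (s j).
Proof.
move=> uP; have us : (perm_mx s : 'M[F]_4) \is a GRing.unit by apply: unitmx_perm.
have dE : (perm_mx s)^-1 * delta_mx i j * perm_mx s = delta_mx (s i) (s j) :> 'M[F]_4.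
  have -> : (perm_mx s)^-1 = perm_mx s^-1 :> 'M[F]_4 by rewrite perm_mxV.
  rewrite -[X in _ * perm_mx X]invgK -!mulmxE -row_permE -col_permE.
  apply/matrixP => k l; rewrite !mxE.
  by rewrite -(inj_eq (@perm_inj _ s)) permKV -(inj_eq (@perm_inj _ s) _ j) permKV.
by rewrite /munit invrM // -dE !mulrA.
Qed.

Lemma sort_degrees (T : 'I_4 -> G) : injective T ->
  exists s : 'S_4, forall i j : 'I_4, (i < j)%N -> gpos le (T (s j) - T (s i)).
Proof.
move=> T_inj; pose r := relpre T le; pose e := sort r (enum 'I_4).
have e_sz : size e = 4 by rewrite size_sort size_enum_ord.
have e_uniq : uniq e by rewrite sort_uniq enum_uniq.
have e_sorted : sorted r e by apply: sort_sorted => i j; apply: (og_le_total leG).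
have f_inj : injective (fun i : 'I_4 => nth ord0 e i).
  by move=> i j /eqP; rewrite nth_uniq ?e_sz // => /eqP/val_inj.
exists (perm f_inj) => i j ij; rewrite !permE gpos_sub //; apply/andP; split.
  apply: (sorted_ltn_nth _ ord0 e_sorted) => //; rewrite ?inE ?e_sz //.
  by move=> x y z; apply: (og_le_trans leG).
by rewrite (inj_eq T_inj) nth_uniq ?e_sz // neq_ltn ij.
Qed.

Theorem grading_elementary : exists2 T : 'I_4 -> G,
  (forall i j : 'I_4, (i < j)%N -> gpos le (T j - T i)) & iso_gradings R (elem_grading T).
Proof.
have [P uP diagR] := neutral_codiagonalizable.
have [T T_inj TU] := munit_degrees (uP := uP) diagR.
have [s sP] := sort_degrees T_inj.
exists (fun i => T (s i)) => //.
have us : (perm_mx s : 'M[F]_4) \is a GRing.unit by apply: unitmx_perm.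
apply: (iso_of_munits (P := perm_mx s * P)); first by rewrite unitrMr.
by move=> i j; rewrite munit_perm // TU.
Qed.

End Grading.

(** * Invariance under isomorphism of gradings *)

Section IsoTransfer.
Variables (G : zmodType) (F : fieldType) (A B : G -> {vspace 'M[F]_4}).
Hypothesis isoAB : iso_gradings A B.

Lemma iso_TG_ids p : TG_ids A p <-> TG_ids B p.
Proof.
have [f [[f' fK f'K] AB]] := isoAB.
have evalE (s : gvar G -> 'M[F]_4) : geval (f \o s) p = f (geval s p).
  rewrite /geval linear_sum; apply: eq_bigr => m _; rewrite linearZ; congr (_ *: _).
  by rewrite rmorph_prod.
split=> idp s sR.
  have -> : geval s p = geval (f \o (f' \o s)) p.
    apply: eq_bigr => m _; congr (_ *: _); apply: eq_bigr => x _.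
    by rewrite /= f'K.
  rewrite evalE idp ?linear0 // => x.
  by have /AB[y yA /= ->] := sR x; rewrite fK.
apply: (can_inj fK); rewrite -evalE linear0; apply: idp => x /=.
by apply/AB; exists (s x).
Qed.

Lemma iso_eq0 g : A g = 0%VS <-> B g = 0%VS.
Proof.
have [f [[f' fK f'K] AB]] := isoAB; split=> R0; apply/eqP; rewrite -subv0; apply/subvP => y.
  by move=> /AB[x + ->]; rewrite R0 !memv0 => /eqP->; rewrite linear0.
move=> yA; have : f y \in B g by apply/AB; exists y.
by rewrite R0 !memv0 -[y == 0](inj_eq (can_inj fK)) linear0.
Qed.

Lemma iso_gens p : gens_11 A p <-> gens_11 B p.
Proof.
by split=> -[?|[?|[x [R0 ->]]]]; [left|right; left|right; right; exists x; split=> //; apply/iso_eq0|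
  left|right; left|right; right; exists x; split=> //; apply/iso_eq0].
Qed.

Lemma iso_basis : TG_generated (gens_11 A) (TG_ids A) <-> TG_generated (gens_11 B) (TG_ids B).
Proof.
split; apply: TG_generated_ext => p.
- exact: iso_gens.
- exact: iso_TG_ids.
- by split=> /iso_gens.
by split=> /iso_TG_ids.
Qed.

End IsoTransfer.

Theorem mainTheorem11 (G : zmodType) (le : rel G) (F : closedFieldType)
    (Rg : G -> {vspace 'M[F]_4}) :
  ordered_group le ->
  [pchar F] =i pred0 ->
  is_grading Rg ->
  (forall x y : 'M[F]_4, x \in Rg 0 -> y \in Rg 0 -> x * y = y * x) ->
  (TG_generated (gens_11 Rg) (TG_ids Rg) <->
   exists a b : G,
     [/\ gpos le a, gpos le b, a != b *+ 2, a *+ 2 != b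
       & iso_gradings Rg (elem_grading (seq4 a b))]).
Proof.
move=> leG F0 gradR commR; split=> [basR|[a [b [a0 b0 ab2 ba2 isoR]]]]; last first.
  apply/(iso_basis isoR); apply: elem_grading_basis => //.
    exact: seq4_inj leG _ _ a0 b0.
  exact: seq4_sets leG _ _ a0 b0 ab2 ba2.
have [T T_sorted isoT] := grading_elementary leG gradR commR.
have basT := (iso_basis isoT).1 basR.
have [a0 b0 ab2 ba2] := sorted_generic leG T_sorted basT.
exists (T (@Ordinal 4 1 isT) - T ord0), (T (@Ordinal 4 2 isT) - T (@Ordinal 4 1 isT)); split=> //.
(* An elementary grading depends only on differences of degrees, and these agree by [sorted_diff],
   so the same isomorphism serves. *)
have [f [fbij fP]] := isoT; exists f; split=> // g y; rewrite -fP.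
by split=> /mem_elem_grading yg; apply/mem_elem_grading => p q /yg;
  rewrite (sorted_diff leG T_sorted basT p q).
Qed.
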